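(* Let $\Omega\subset\mathbb{R}^n$, $n\ge 2$, be a bounded domain and $T>0$. Let $u:\Omega_T\cup P_T\to\mathbb{R}$ be upper semi-continuous and $v:\Omega_T\cup P_T\to\mathbb{R}$ be lower semi-continuous in $\Omega_T\cup P_T$, and suppose that, in the viscosity sense, $$\Delta_\infty u\ge 3u^2u_t\quad\text{and}\quad \Delta_\infty v\le 3v^2v_t\quad\text{in }\Omega_T .$$ Assume that $\min\left(\inf_{\Omega_T\cup P_T}u,\ \inf_{\Omega_T\cup P_T}v\right)>0$. If $\sup_{P_T}v<\infty$ and $u\le v$ on $P_T$, then $u\le v$ in $\Omega_T$.
   Context: Notation: $\Omega_T=\Omega\times(0,T)$; the parabolic boundary is $P_T=(\Omega\times\{0\})\cup(\partial\Omega\times[0,T))$, so $\Omega_T\cup P_T=\overline\Omega\times[0,T)$. $\Delta_\infty\phi=\sum_{i,j=1}^n\frac{\partial\phi}{\partial x_i}\frac{\partial\phi}{\partial x_j}\frac{\partial^2\phi}{\partial x_i\partial x_j}$ (derivatives in $x$ only). $\mathcal S(n)$ is the set of symmetric $n\times n$ real matrices. Semi-jets: for $(y,s)\in\Omega_T$, $(a,p,X)\in\mathbb{R}\times\mathbb{R}^n\times\mathcal S(n)$ belongs to $\mathcal P^+_{\Omega_T}u(y,s)$ if $u(x,t)\le u(y,s)+a(t-s)+\langle p,x-y\rangle+\tfrac12\langle X(x-y),x-y\rangle+o(|t-s|+|x-y|^2)$ as $(x,t)\to(y,s)$, $(x,t)\in\Omega_T$; and $\mathcal P^-_{\Omega_T}u=-\mathcal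 P^+_{\Omega_T}(-u)$. Viscosity inequalities: $\Delta_\infty u\ge 3u^2u_t$ in $\Omega_T$ means that $u$ is upper semi-continuous in $\Omega_T$ and $\langle Xp,p\rangle-3a\,u(y,s)^2\ge 0$ for all $(y,s)\in\Omega_T$ and all $(a,p,X)\in\mathcal P^+_{\Omega_T}u(y,s)$. $\Delta_\infty v\le 3v^2v_t$ in $\Omega_T$ means that $v$ is lower semi-continuous in $\Omega_T$ and $\langle Yq,q\rangle-3b\,v(y,s)^2\le 0$ for all $(y,s)\in\Omega_T$ and all $(b,q,Y)\in\mathcal P^-_{\Omega_T}v(y,s)$. *)

(* Defs.v *)
From HB Require Import structures.
From mathcomp Require Import all_boot all_order all_algebra.
From mathcomp Require Import all_classical all_reals all_analysis.

Set Implicit Arguments.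
Unset Strict Implicit.
Unset Printing Implicit Defensive.

Import Order.TTheory GRing.Theory Num.Theory.
Import numFieldNormedType.Exports.

Local Open Scope classical_set_scope.
Local Open Scope ring_scope.

(* Points of space are row vectors, points of space-time are pairs (x, t).
   Functions on a subset D of space-time are represented by total functions
   whose values outside D are never inspected. *)

Section Domains.
Variables (R : realType) (n : nat).

Definition domain (Omega : set 'rV[R]_n) : Prop :=
  [/\ Omega !=set0, open Omega & connected Omega].

Definition boundary (A : set 'rV[R]_n) : set 'rV[R]_n := closure A `\` A°.

Definition cylinder (Omega : set 'rV[R]_n) (T : R) : set ('rV[R]_n * R) :=
  Omega `*` `]0, T[.

Definition parabolic_boundary (Omega : set 'rV[R]_n) (T : R) :
    set ('rV[R]_n * R) :=
  (Omega `*` [set 0]) `|` (boundary Omega `*` `[0, T[).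

End Domains.

(* Semicontinuity on D for the relative topology of D. *)
Definition lower_semicontinuous_on (R : realType) (X : topologicalType)
    (D : set X) (f : X -> R) : Prop :=
  lower_semicontinuous (EFin \o f : subspace D -> \bar R).

Definition upper_semicontinuous_on (R : realType) (X : topologicalType)
    (D : set X) (f : X -> R) : Prop :=
  lower_semicontinuous_on D (\- f).

Section SemiJets.
Variables (R : realType) (n : nat).
Implicit Types (D : set ('rV[R]_n * R)) (u v : 'rV[R]_n * R -> R).

(* The Euclidean inner product; the library norm on 'rV[R]_n is the sup norm. *)
Definition dot (x y : 'rV[R]_n) : R := \sum_(i < n) x 0 i * y 0 i.

(* For symmetric X, the row vector x *m X is the transpose of X x^T, so that
   dot (x *m X) x is the quadratic form <X x, x>. *)
Definition superjet D u (z : 'rV[R]_n * R) : set (R * 'rV[R]_n * 'M[R]_n) :=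
  [set j | let: (a, p, X) := j in let: (y, s) := z in
    let F := within D (nbhs z) in
    X^T = X /\
    exists2 r : 'rV[R]_n * R -> R,
      r =o_F (fun w => `|w.2 - s| + dot (w.1 - y) (w.1 - y)) &
      \forall w \near F,
        u w <= u z + a * (w.2 - s) + dot p (w.1 - y)
               + 2^-1 * dot ((w.1 - y) *m X) (w.1 - y) + r w].

Definition subjet D u (z : 'rV[R]_n * R) : set (R * 'rV[R]_n * 'M[R]_n) :=
  -%R @` superjet D (\- u) z.

(* Delta_infty u >= 3 u^2 u_t in D, in the viscosity sense. *)
Definition viscosity_subsolution D u : Prop :=
  upper_semicontinuous_on D u /\
  forall z a p X, D z -> superjet D u z (a, p, X) ->
    dot (p *m X) p - 3 * a * u z ^+ 2 >= 0.

(* Delta_infty v <= 3 v^2 v_t in D, in the viscosity sense. *)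
Definition viscosity_supersolution D v : Prop :=
  lower_semicontinuous_on D v /\
  forall z b q Y, D z -> subjet D v z (b, q, Y) ->
    dot (q *m Y) q - 3 * b * v z ^+ 2 <= 0.

End SemiJets.

(* Main.v *)
Require Import Defs.
From HB Require Import structures.
From mathcomp Require Import all_boot all_order all_algebra.
From mathcomp Require Import all_classical all_reals all_analysis.
From mathcomp Require Import ring lra.

Set Implicit Arguments.
Unset Strict Implicit.
Unset Printing Implicit Defensive.

Import Order.TTheory GRing.Theory Num.Theory.
Import numFieldNormedType.Exports.

Local Open Scope classical_set_scope.
Local Open Scope ring_scope.

(** Put A = ln u and B = - ln v. Both satisfy inequalities that no longer involve
    the values of the functions,
      3 A_t <= Delta_infty A + |D A|^4,  3 B_t <= Delta_infty B - |D B|^4,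
    so that they are invariant under translations and under the addition of
    constants ([ln_visc_subsolution], [ln_visc_supersolution]). If u > v
    somewhere, A + B has a positive value at an interior point. Subtracting from
    A a function of time that increases, slowly first and steeply before a final
    time T2 < T, makes the first inequality strict by 3 e and makes A + B
    nonpositive on the parabolic boundary and at time T2. It remains to exclude
    a positive interior maximum of A + B.

    The usual argument doubles variables and invokes the theorem on sums, which
    rests on Alexandrov's theorem. The infinity-Laplacian allows an elementary
    replacement, in the spirit of comparison with cones. Replace A and B by
    their sup-convolutions W and V with a quadratic kernel. These satisfy the
    same inequalities ([supconv_upper_jet]) and are supported from below at
    every point by paraboloids of fixed opening ([supconv_lower_tangent]). At a
    maximum z0 of W + V each is therefore differentiable, with opposite slopes
    (p, b) and (- p, - b), and test functions touching near z0 have slopes close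
    to these ([lower_tangent_continuous]). If p = 0, the paraboloids touching at
    z0 contradict the inequalities. If p <> 0, then near z0 the second derivative
    in the direction of the gradient is, in the sense of viscosity, at least k1
    for W and k2 for V, for suitable constants with k1 + k2 > 0.

    This one-dimensional information is exploited by comparison, on a time
    slice, with functions s |x - x1| + k |x - x1|^2 / 2: along their gradient the
    second derivative is exactly k, whatever the curvature of the spheres. The
    outcome is the midpoint inequality ([midpoint_estimate]): for |y1 - x1| <= r
    there is y3 with |y3 - x1| <= 2 r and
      W y1 <= (W x1 + W y3) / 2 - k1 r^2 / 2,
    and similarly V y2 <= (V x1 + V y4) / 2 - k2 r^2 / 2. Now let (y1, y2)
    maximize W y1 + V y2 among simultaneous points at distance at most 2 r, and
    let x1 be their midpoint. The pairs (x1, y4) and (y3, x1) compete in this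
    maximum, whereas the sum of the two inequalities makes one of them strictly
    better than (y1, y2). As r tends to 0 the maximizing pairs accumulate at a
    maximum z0 of W + V, where the argument applies ([doubling_contradiction]). *)

(** * Euclidean geometry of space-time *)

Section Euclid.
Context (R : realType) (n : nat).
Implicit Types (x y h p : 'rV[R]_n) (a b c : R) (X : 'M[R]_n).

Lemma dotC x y : dot x y = dot y x.
Proof. by apply: eq_bigr => i _; rewrite mulrC. Qed.

Lemma dotDl x y h : dot (x + y) h = dot x h + dot y h.
Proof. by rewrite -big_split; apply: eq_bigr => i _; rewrite mxE mulrDl. Qed.

Lemma dotDr x y h : dot h (x + y) = dot h x + dot h y.
Proof. by rewrite !(dotC h) dotDl. Qed.

Lemma dotZl a x y : dot (a *: x) y = a * dot x y.
Proof. by rewrite /dot mulr_sumr; apply: eq_bigr => i _; rewrite mxE mulrA. Qed.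

Lemma dotZr a x y : dot x (a *: y) = a * dot x y.
Proof. by rewrite dotC dotZl dotC. Qed.

Lemma dotNl x y : dot (- x) y = - dot x y.
Proof. by rewrite -scaleN1r dotZl mulN1r. Qed.

Lemma dotNr x y : dot x (- y) = - dot x y.
Proof. by rewrite dotC dotNl dotC. Qed.

Definition dotE := (dotDl, dotDr, dotNl, dotNr, dotZl, dotZr).

Lemma dot0l x : dot 0 x = 0.
Proof. by rewrite -(scale0r 0) dotZl mul0r. Qed.

Lemma dot0r x : dot x 0 = 0.
Proof. by rewrite dotC dot0l. Qed.

Lemma dot_ge0 x : 0 <= dot x x.
Proof. by apply: sumr_ge0 => i _; rewrite -expr2 sqr_ge0. Qed.

Lemma coord_sqr_le_dot x i : x 0 i ^+ 2 <= dot x x.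
Proof.
rewrite /dot (bigD1 i) //= -expr2 lerDl.
by apply: sumr_ge0 => j _; rewrite -expr2 sqr_ge0.
Qed.

Lemma dot_eq0 x : (dot x x == 0) = (x == 0).
Proof.
apply/idP/eqP => [/eqP x0|->]; last by rewrite dot0l.
apply/rowP => i; rewrite mxE; apply/eqP; rewrite -sqrf_eq0 eq_le sqr_ge0 andbT.
by rewrite -x0 coord_sqr_le_dot.
Qed.

Lemma dot_gt0 x : (0 < dot x x) = (x != 0).
Proof. by rewrite lt_def dot_ge0 andbT dot_eq0. Qed.

Lemma cauchy_schwarz x y : dot x y ^+ 2 <= dot x x * dot y y.
Proof.
have [->|y0] := eqVneq y 0; first by rewrite !dot0r expr0n mulr0.
have := dot_ge0 (dot y y *: x - dot x y *: y).
have -> : dot (dot y y *: x - dot x y *: y) (dot y y *: x - dot x y *: y) =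
    dot y y * (dot x x * dot y y - dot x y ^+ 2).
  by rewrite !dotE (dotC y x); ring.
by rewrite pmulr_rge0 ?dot_gt0// subr_ge0.
Qed.

Lemma dotD_le2 x y : dot (x + y) (x + y) <= 2 * (dot x x + dot y y).
Proof. have := dot_ge0 (x - y); rewrite !dotE (dotC y x); lra. Qed.

Lemma dotB_sym x y : dot (x - y) (x - y) = dot (y - x) (y - x).
Proof. by rewrite -opprB !dotE; lra. Qed.

(** The squared Euclidean distance of space-time; it is smooth, unlike the
    distance, and enters the regularizing kernel and the definition of
    neighbourhoods alike. *)
Definition sqdist (z w : 'rV[R]_n * R) : R :=
  dot (z.1 - w.1) (z.1 - w.1) + (z.2 - w.2) ^+ 2.

Lemma sqdist_ge0 z w : 0 <= sqdist z w.
Proof. by rewrite addr_ge0 ?dot_ge0 ?sqr_ge0. Qed.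

Lemma sqdistxx z : sqdist z z = 0.
Proof. by rewrite /sqdist !subrr dot0l expr0n addr0. Qed.

Lemma sqdistC z w : sqdist z w = sqdist w z.
Proof. by rewrite /sqdist dotB_sym; ring. Qed.

Lemma sqdist_triangle z w v : sqdist z w <= 2 * (sqdist z v + sqdist v w).
Proof.
rewrite /sqdist; have := dotD_le2 (z.1 - v.1) (v.1 - w.1).
have -> : z.1 - v.1 + (v.1 - w.1) = z.1 - w.1 by rewrite addrA subrK.
have := sqr_ge0 ((z.2 - v.2) - (v.2 - w.2)); nra.
Qed.

Lemma continuous_dot (U : topologicalType) (f g : U -> 'rV[R]_n) :
  continuous f -> continuous g -> continuous (fun u => dot (f u) (g u)).
Proof.
move=> cf cg u; apply: cvg_big => [|i _]; first exact: add_continuous.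
apply: cvgM.
  by apply: (@cvg_comp _ _ _ f (fun x : 'rV[R]_n => x 0 i) _ _ _ (cf u));
    exact: coord_continuous.
by apply: (@cvg_comp _ _ _ g (fun x : 'rV[R]_n => x 0 i) _ _ _ (cg u));
  exact: coord_continuous.
Qed.

Lemma continuous_sqdist (U : topologicalType) (f g : U -> 'rV[R]_n * R) :
  continuous f -> continuous g -> continuous (fun u => sqdist (f u) (g u)).
Proof.
move=> cf cg u.
have c1 (h : U -> 'rV[R]_n * R) : continuous h -> continuous (fun v => (h v).1).
  by move=> ch v; apply: (@cvg_comp _ _ _ h fst _ _ _ (ch v)); exact: cvg_fst.
have c2 (h : U -> 'rV[R]_n * R) : continuous h -> continuous (fun v => (h v).2).
  by move=> ch v; apply: (@cvg_comp _ _ _ h snd _ _ _ (ch v)); exact: cvg_snd.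
have cB1 : continuous (fun v => (f v).1 - (g v).1).
  by move=> v; apply: cvgB; exact: c1.
have cB2 : continuous (fun v => (f v).2 - (g v).2).
  by move=> v; apply: cvgB; exact: c2.
apply: cvgD; last by apply: cvgM; exact: cB2.
exact: (continuous_dot cB1 cB1).
Qed.

(** The topology of row vectors is that of the sup norm, so Euclidean balls
    have to be compared with boxes. *)
Lemma nbhs_sqdist (z : 'rV[R]_n * R) (P : set ('rV[R]_n * R)) :
  nbhs z P <-> exists2 rho, 0 < rho & forall w, sqdist w z < rho -> P w.
Proof.
split=> [/nbhs_ballP[e /= e0 eP]|[rho rho0 rhoP]].
  exists (e ^+ 2) => [|w wz]; first by rewrite exprn_gt0.
  apply: eP; split.
    split=> // i j; rewrite ord1; rewrite /ball /=.
    rewrite -ltr_sqr ?nnegrE// ?ltW// real_normK ?num_real//.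
    apply: le_lt_trans wz; have := coord_sqr_le_dot (w.1 - z.1) j.
    rewrite !mxE /sqdist; have := sqr_ge0 (w.2 - z.2); nra.
  rewrite /ball /= -ltr_sqr ?nnegrE// ?ltW// real_normK ?num_real//.
  apply: le_lt_trans wz; rewrite /sqdist.
  have := dot_ge0 (w.1 - z.1); nra.
have : (fun w => sqdist w z) @ z --> sqdist z z.
  by apply: (@continuous_sqdist _ id (fun=> z)) => // ?; [exact: cvg_id|exact: cvg_cst].
rewrite sqdistxx => /cvgr_lt /(_ _ rho0); apply: filterS; exact: rhoP.
Qed.

End Euclid.

(** * Upper semicontinuity *)

Section Usc.
Context (R : realType).

Definition usc_on (X : topologicalType) (K : set X) (f : X -> R) : Prop :=
  forall x, K x -> forall c, f x < c -> \forall w \near x, K w -> f w < c.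

Lemma upper_semicontinuous_on_usc (X : topologicalType) (K : set X)
    (f : X -> R) : upper_semicontinuous_on K f -> usc_on K f.
Proof.
move=> uf x Kx c fc; have := uf x (- c); rewrite /= !lte_fin ltrN2 => /(_ fc)[V].
rewrite {1}/nbhs /= -nbhs_subspace_in// => xV Vf.
by apply: filterS xV => w /Vf; rewrite /= lte_fin ltrN2.
Qed.

Lemma usc_onS (X : topologicalType) (K K' : set X) (f : X -> R) :
  K `<=` K' -> usc_on K' f -> usc_on K f.
Proof.
by move=> KK' uf x /KK' K'x c /(uf x K'x c); apply: filterS => w + /KK'; apply.
Qed.

Lemma usc_onD (X : topologicalType) (K : set X) (f g : X -> R) :
  usc_on K f -> usc_on K g -> usc_on K (fun x => f x + g x).
Proof.
move=> uf ug x Kx c fgc.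
have e0 : 0 < (c - (f x + g x)) / 2 by lra.
have := ug x Kx (g x + (c - (f x + g x)) / 2); rewrite ltrDl => /(_ e0) gx.
have := uf x Kx (f x + (c - (f x + g x)) / 2); rewrite ltrDl => /(_ e0).
by apply: filterS2 gx => w gw fw Kw; move: (gw Kw) (fw Kw); lra.
Qed.

Lemma continuous_usc_on (X : topologicalType) (K : set X) (f : X -> R) :
  continuous f -> usc_on K f.
Proof. by move=> cf x _ c /(cvgr_lt _ (cf x)); apply: filterS. Qed.

Lemma usc_on_ln (X : topologicalType) (K : set X) (f : X -> R) :
  (forall x, K x -> 0 < f x) -> usc_on K f -> usc_on K (fun x => ln (f x)).
Proof.
move=> f0 uf x Kx c fc; have fc' : f x < expR c.
  by rewrite -ltr_ln ?posrE ?expR_gt0 ?f0// expRK.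
apply: filterS (uf x Kx _ fc') => w fw Kw.
by rewrite -(expRK c) ltr_ln ?posrE ?expR_gt0 ?f0 ?fw.
Qed.

Lemma usc_on_lnN (X : topologicalType) (K : set X) (f : X -> R) :
  (forall x, K x -> 0 < f x) -> usc_on K (\- f) ->
  usc_on K (fun x => - ln (f x)).
Proof.
move=> f0 uf x Kx c fc.
have fc' : - f x < - expR (- c).
  by rewrite ltrN2 -ltr_ln ?posrE ?expR_gt0 ?f0// expRK ltrNl.
apply: filterS (uf x Kx _ fc') => w fw Kw; rewrite ltrNl -[ltLHS]expRK.
by rewrite ltr_ln ?posrE ?expR_gt0 ?f0// -ltrN2 fw.
Qed.

(** If no point of [K] were a maximizer, near each [x] in [K] the function
    would stay below some value [f y]; as these values form a directed
    filter base, compactness would give a [y] in [K] with [f y < f y]. *)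
Lemma usc_max (X : topologicalType) (K : set X) (f : X -> R) :
  K !=set0 -> compact K -> usc_on K f ->
  exists2 x, K x & forall y, K y -> f y <= f x.
Proof.
move=> [x0 Kx0] /compact_near_coveringP cK uf; apply: contrapT => nmax.
have larger x : K x -> exists2 y, K y & f x < f y.
  move=> Kx; apply: contrapT => nx; apply: nmax; exists x => // y Ky.
  by rewrite leNgt; apply/negP => xy; apply: nx; exists y.
pose F := filter_from K (fun y => [set y' | K y' /\ f y <= f y']).
have FF : Filter F.
  apply: filter_from_filter; first by exists x0.
  move=> y y' Ky Ky'; have [yy'|/ltW y'y] := leP (f y) (f y').
    by exists y' => // w [Kw y'w]; do 2!split=> //; exact: le_trans y'w.
  by exists y => // w [Kw yw]; do 2!split=> //; exact: le_trans yw.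
have /cK : forall x, K x -> \forall x' \near x & y \near F, K x' -> f x' < f y.
  move=> x Kx; have [y Ky xy] := larger _ Kx.
  exists ([set w | K w -> f w < f y], [set y' | K y' /\ f y <= f y']) => /=.
    by split; [exact: uf|exists y].
  by move=> [w y'] /= [fw [_ yy']] Kw; exact: lt_le_trans (fw Kw) yy'.
by case=> y Ky /(_ y (conj Ky (lexx _)) y Ky Ky); rewrite ltxx.
Qed.

End Usc.

(** * Second-order upper expansions *)

Section Jets.
Context (R : realType) (n : nat).
Implicit Types (z w : 'rV[R]_n * R) (h p : 'rV[R]_n) (a : R) (X : 'M[R]_n).

(** A superjet up to the symmetry of [X], whose remainder is quantified by
    epsilon so that no remainder function has to be carried along. *)
Definition upper_jet (D : set ('rV[R]_n * R)) (f : 'rV[R]_n * R -> R) z a p X :=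
  forall e, 0 < e -> \forall w \near z, D w ->
    f w <= f z + a * (w.2 - z.2) + dot p (w.1 - z.1)
           + 2^-1 * dot ((w.1 - z.1) *m X) (w.1 - z.1)
           + e * (`|w.2 - z.2| + dot (w.1 - z.1) (w.1 - z.1)).

Lemma upper_jet_superjet D f z a p X :
  X^T = X -> upper_jet D f z a p X -> superjet D f z (a, p, X).
Proof.
case: z => y s XT jet; split=> //.
pose P w := f (y, s) + a * (w.2 - s) + dot p (w.1 - y)
               + 2^-1 * dot ((w.1 - y) *m X) (w.1 - y).
(* The smallest admissible remainder is the excess of [f] over its expansion. *)
exists (fun w => Num.max 0 (f w - P w)); last first.
  by apply: nearW => w; rewrite -/(P w) -lerBlDl le_max lexx orbT.
apply/eqoP => e e0; have := jet e e0.
rewrite /within /=; apply: filterS => w + Dw => /(_ Dw) fw.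
have N0 : 0 <= `|w.2 - s| + dot (w.1 - y) (w.1 - y) by rewrite addr_ge0 ?dot_ge0.
rewrite (ger0_norm N0) ger0_norm ?le_max ?lexx// ge_max mulr_ge0 ?(ltW e0)//=.
by move: fw; rewrite /P /=; lra.
Qed.

Lemma upper_jet_near D D' f z a p X :
  (\forall w \near z, D' w -> D w) -> upper_jet D f z a p X ->
  upper_jet D' f z a p X.
Proof.
move=> DD' jet e /jet; apply: filterS2 DD' => w DD' + /DD' Dw.
exact.
Qed.

Lemma time_sqr_small z (L e : R) : 0 < e ->
  \forall w \near z, L * (w.2 - z.2) ^+ 2 <= e * `|w.2 - z.2|.
Proof.
move=> e0; have L1 : 0 < `|L| + 1 by rewrite ltr_wpDl.
have eL : 0 < e / (`|L| + 1) by exact: divr_gt0.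
apply/nbhs_sqdist; exists ((e / (`|L| + 1)) ^+ 2) => [|w]; first exact: exprn_gt0.
rewrite /sqdist; have := dot_ge0 (w.1 - z.1); move: (w.2 - z.2) => tau h0 wz.
have taue : `|tau| <= e / (`|L| + 1).
  by rewrite -ler_sqr ?nnegrE ?(ltW eL)// real_normK ?num_real//; lra.
have -> : tau ^+ 2 = `|tau| * `|tau| by rewrite -expr2 real_normK ?num_real.
rewrite mulrA; apply: ler_wpM2r => //.
apply: le_trans (_ : (`|L| + 1) * `|tau| <= _).
  by rewrite ler_wpM2r//; have := ler_norm L; lra.
by rewrite mulrC -ler_pdivlMr.
Qed.

Lemma dot_mulmx_bound X :
  exists2 C, 0 <= C & forall h, `|dot (h *m X) h| <= C * dot h h.
Proof.
exists (\sum_j \sum_i `|X i j|) => [|h].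
  by apply: sumr_ge0 => j _; apply: sumr_ge0 => i _.
rewrite {1}/dot mulr_suml; apply: le_trans (ler_norm_sum _ _ _) _.
apply: ler_sum => j _; rewrite mxE mulr_suml mulr_suml.
apply: le_trans (ler_norm_sum _ _ _) _; apply: ler_sum => i _.
rewrite mulrAC normrM mulrC ler_wpM2l// normrM.
have := coord_sqr_le_dot h i; have := coord_sqr_le_dot h j.
rewrite -(real_normK (num_real (h 0 i))) -(real_normK (num_real (h 0 j))).
have := sqr_ge0 (`|h 0 i| - `|h 0 j|); nra.
Qed.

(** The derivative of the error is [expR c - 1 - c], which the two bounds
    [1 + c <= expR c] and [expR c <= 1 / (1 - c)] make quadratic; the mean value
    theorem gains one more power. *)
Lemma expR_taylor2 (x : R) :
  `|x| <= 2^-1 -> `|expR x - 1 - x - x ^+ 2 / 2| <= 2 * `|x| ^+ 3.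
Proof.
move=> x2; pose f (y : R) := expR y - 1 - y - y ^+ 2 / 2.
have df (y : R) : is_derive y (1 : R) f (expR y - 1 - y).
  rewrite /f; apply: is_derive_eq.
  by rewrite /GRing.scale /= !mulr1 subr0; field.
have cf : continuous f.
  by move=> y; apply: differentiable_continuous; apply/derivable1_diffP; exact: ex_derive.
have df_le (c : R) : `|c| <= `|x| -> `|expR c - 1 - c| <= 2 * `|x| ^+ 2.
  move=> cx; have c2 : `|c| <= 2^-1 by exact: le_trans x2.
  have e1 := expR_ge1Dx c; have e2 := expR_ge1Dx (- c).
  have e3 : expR c * expR (- c) = 1 by exact: expRxMexpNx_1.
  have e4 := expR_gt0 c.
  rewrite ger0_norm; last lra.
  have : `|c| ^+ 2 <= `|x| ^+ 2 by rewrite lerXn2r ?nnegrE.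
  move: c2; rewrite ler_norml real_normK ?num_real// => /andP[c2 c2'] cx2.
  have e5 : expR c * (1 - c) <= 1 by rewrite -[leRHS]e3 ler_pM2l.
  have e6 : (expR c - 1 - c) * (1 - c) <= c ^+ 2 by lra.
  nra.
suff [c cx fx] : exists2 c, `|c| <= `|x| & f x = (expR c - 1 - c) * x.
  rewrite -/(f x) fx normrM exprS mulrCA mulrC; apply: ler_wpM2l => //.
  by rewrite df_le.
have f0 : f 0 = 0 by rewrite /f expR0 expr0n /=; lra.
have [x0|x0] := leP 0 x.
  have [c] := @MVT_segment _ f (fun y => expR y - 1 - y) 0 x x0
    (fun y _ => df y) (continuous_subspaceT cf).
  rewrite f0 !subr0 in_itv /= => /andP[c0 cx] fx; exists c => //.
  by rewrite !ger0_norm.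
have [c] := @MVT_segment _ f (fun y => expR y - 1 - y) x 0 (ltW x0)
  (fun y _ => df y) (continuous_subspaceT cf).
rewrite f0 sub0r in_itv /= => /andP[xc c0] fx; exists c; last lra.
by rewrite !ler0_norm ?lerN2// ltW.
Qed.

End Jets.

Section ExpJet.
Context (R : realType) (n : nat).
Implicit Types (z w : 'rV[R]_n * R) (h p : 'rV[R]_n) (a : R) (X : 'M[R]_n).

Lemma expR_upper (sigma m M : R) : sigma = 1 \/ sigma = -1 -> m <= M ->
  `|M| <= 2^-1 ->
  sigma * (expR (sigma * m) - 1) <= M + sigma * M ^+ 2 / 2 + 2 * `|M| ^+ 3.
Proof.
move=> sE mM M2; case: sE => ->.
  have := expR_taylor2 M2; rewrite !mul1r ler_norml => /andP[_].
  by have := mM; rewrite -ler_expR; lra.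
rewrite -(normrN M) in M2 *; have := expR_taylor2 M2.
rewrite !mulN1r ler_norml => /andP[+ _]; rewrite sqrrN.
have : expR (- M) <= expR (- m) by rewrite ler_expR lerN2.
lra.
Qed.

(** The error made when the square of an increment [M] is replaced by the square
    of its first-order part [q]. Here [hh] stands for |h|^2, [q] for <p, h>, and
    [r] gathers the terms of order [N = |tau| + |h|^2]. *)
Lemma expansion_error (sigma N hh q r M P C eta : R) :
  sigma = 1 \/ sigma = -1 -> 0 <= N -> N <= eta -> eta <= 1 ->
  0 <= hh -> hh <= N -> 0 <= P -> q ^+ 2 <= P * hh -> `|q| <= eta ->
  0 <= C -> `|r| <= C * N -> M = q + r ->
  `|M| <= (1 + C) * eta /\
  sigma * (M ^+ 2 - q ^+ 2) / 2 + 2 * `|M| ^+ 3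
    <= eta * (C + C ^+ 2 + 4 * (1 + C) * (P + C ^+ 2)) * N.
Proof.
move=> sE N0 Neta eta1 hh0 hhN P0 qP qeta C0 rC ME.
have eta0 : 0 <= eta by exact: le_trans Neta.
have CN : C * N <= C * eta by rewrite ler_wpM2l.
have Mle : `|M| <= (1 + C) * eta.
  by rewrite ME; apply: le_trans (ler_normD _ _) _; lra.
split=> //.
have r2 : r ^+ 2 <= C ^+ 2 * eta * N.
  have -> : r ^+ 2 = `|r| ^+ 2 by rewrite real_normK ?num_real.
  apply: (@le_trans _ _ ((C * N) ^+ 2)); first by rewrite lerXn2r ?nnegrE ?mulr_ge0.
  rewrite exprMn -mulrA ler_wpM2l ?exprn_ge0// expr2 ler_wpM2r//.
have qr : `|q * r| <= eta * (C * N) by rewrite normrM ler_pM.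
have T1 : sigma * (M ^+ 2 - q ^+ 2) / 2 <= eta * (C + C ^+ 2) * N.
  have -> : M ^+ 2 - q ^+ 2 = 2 * (q * r) + r ^+ 2 by rewrite ME; ring.
  move: qr; rewrite ler_norml => /andP[qr1 qr2].
  have r20 := sqr_ge0 r.
  by case: sE => ->; lra.
have M2 : M ^+ 2 <= 2 * (P + C ^+ 2) * N.
  have q2 : q ^+ 2 <= P * N by apply: le_trans qP _; rewrite ler_wpM2l.
  have r2' : r ^+ 2 <= C ^+ 2 * N.
    apply: le_trans r2 _; rewrite ler_wpM2r// ler_piMr ?exprn_ge0//.
  have := sqr_ge0 (q - r); rewrite ME; nra.
have M3 : `|M| ^+ 3 <= (1 + C) * eta * (2 * (P + C ^+ 2) * N).
  by rewrite exprS real_normK ?num_real// ler_pM ?sqr_ge0.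
lra.
Qed.

(** Composition with [m |-> expR m] or [m |-> - expR (- m)], increasing
    functions whose second derivative is [sigma] times the first. This turns
    a jet of [ln u] into one of [u], and a jet of [- ln v] into one of [- v]. *)
Lemma upper_jet_exp D (A f : 'rV[R]_n * R -> R) z a p X (sigma : R) :
  sigma = 1 \/ sigma = -1 -> D z ->
  (forall w, D w -> f w = sigma * expR (sigma * A w)) ->
  upper_jet D A z a p X ->
  let c := expR (sigma * A z) in
  upper_jet D f z (c * a) (c *: p) (c *: (X + sigma *: (p^T *m p))).
Proof.
move=> sE Dz fE jet c e e0.
have c0 : 0 < c by exact: expR_gt0.
have [CX CX0 XC] := dot_mulmx_bound X.
pose P := dot p p; have P0 : 0 <= P := dot_ge0 p.
pose C := `|a| + CX + 1; have C0 : 0 <= C by rewrite !addr_ge0.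
pose G := C + C ^+ 2 + 4 * (1 + C) * (P + C ^+ 2).
have G0 : 0 <= G by rewrite !(addr_ge0, mulr_ge0, exprn_ge0).
pose e' := Num.min 1 (e / (2 * c)).
have e'0 : 0 < e' by rewrite lt_min ltr01 divr_gt0// mulr_gt0.
have e'1 : e' <= 1 by rewrite ge_min lexx.
have e'e : c * e' <= e / 2.
  have -> : e / 2 = c * (e / (2 * c)) by field; rewrite gt_eqF.
  by rewrite ler_pM2l// ge_min lexx orbT.
pose eta := Num.min 1 (Num.min (1 / (2 * (1 + C))) (e / (2 * c * (1 + G)))).
have eta0 : 0 < eta by rewrite !lt_min ltr01 !divr_gt0// !mulr_gt0// ltr_wpDr.
have eta1 : eta <= 1 by rewrite ge_min lexx.
have etaC : (1 + C) * eta <= 2^-1.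
  have -> : 2^-1 = (1 + C) * (1 / (2 * (1 + C))) by field; rewrite gt_eqF// ltr_wpDr.
  by rewrite ler_pM2l ?ltr_wpDr// ge_min ge_min lexx orbT.
have etaG : c * (eta * G) <= e / 2.
  apply: (@le_trans _ _ (c * (eta * (1 + G)))).
    by rewrite ler_pM2l// ler_pM2l// lerDr.
  have -> : e / 2 = c * (e / (2 * c * (1 + G)) * (1 + G)).
    by field; rewrite !gt_eqF// ltr_wpDr.
  rewrite ler_pM2l//; apply: ler_wpM2r; first by rewrite addr_ge0.
  by rewrite /eta !ge_min lexx !orbT.
have P1 : 0 < P + 1 by rewrite ltr_wpDl.
have near_z : \forall w \near z, sqdist w z < eta ^+ 2 / (4 * (P + 1)).
  by apply/nbhs_sqdist; exists (eta ^+ 2 / (4 * (P + 1))) => //;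
    rewrite divr_gt0 ?exprn_gt0 ?mulr_gt0.
have := jet e' e'0; apply: filterS2 near_z => w wz + Dw => /(_ Dw) Aw.
move: Aw wz; rewrite /sqdist.
set tau := w.2 - z.2; set h := w.1 - z.1; set hh := dot h h => Aw wz.
have hh0 : 0 <= hh := dot_ge0 h.
move: wz; rewrite ltr_pdivlMr ?mulr_gt0// => wz.
have tau2 : `|tau| ^+ 2 = tau ^+ 2 by rewrite real_normK ?num_real.
have tau_eta : `|tau| <= eta / 2.
  rewrite -ler_sqr ?nnegrE ?divr_ge0 ?(ltW eta0)// tau2; have := sqr_ge0 tau; nra.
have hh_eta : hh <= eta / 2 by have := sqr_ge0 tau; nra.
pose N := `|tau| + hh; have N0 : 0 <= N by rewrite addr_ge0.
have hhN : hh <= N by rewrite lerDr.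
have Neta : N <= eta by rewrite /N; lra.
pose q := dot p h.
have qP : q ^+ 2 <= P * hh by exact: cauchy_schwarz.
have qeta : `|q| <= eta.
  rewrite -ler_sqr ?nnegrE ?(ltW eta0)// real_normK ?num_real//.
  apply: le_trans qP _; have := sqr_ge0 tau; nra.
pose r := a * tau + 2^-1 * dot (h *m X) h + e' * N.
have rC : `|r| <= C * N.
  have := XC h; rewrite -/hh => XCh.
  apply: le_trans (ler_normD _ _) _.
  rewrite (ger0_norm (mulr_ge0 (ltW e'0) N0)).
  have := ler_normD (a * tau) (2^-1 * dot (h *m X) h).
  rewrite !normrM (@ger0_norm _ 2^-1)// => arX.
  have aN : `|a| * `|tau| <= `|a| * N by rewrite ler_wpM2l// lerDl.
  have XN : CX * hh <= CX * N by rewrite ler_wpM2l.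
  have eN : e' * N <= 1 * N by rewrite ler_wpM2r.
  have XN0 : 0 <= CX * N by rewrite mulr_ge0.
  by rewrite /C; lra.
have [Mle err] := expansion_error sE N0 Neta eta1 hh0 hhN P0 qP qeta C0 rC erefl.
have Am : A w - A z <= q + r by rewrite /q /r /N; lra.
have := expR_upper sE Am (le_trans Mle etaC).
rewrite (mulrBr sigma (A w)) expRB -/c => /(ler_wpM2l (ltW c0)) fle.
have fz : f w = f z + c * (sigma * (expR (sigma * A w) / c - 1)).
  by rewrite !fE// -/c; field; rewrite gt_eqF.
rewrite {}fz -!addrA lerD2l; apply: le_trans fle _.
have -> : dot (h *m (c *: (X + sigma *: (p^T *m p)))) h =
    c * (dot (h *m X) h + sigma * q ^+ 2).
  rewrite -scalemxAr dotZl mulmxDr dotDl -scalemxAr dotZl mulmxA.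
  have -> : h *m p^T = q%:M.
    apply/rowP => i; rewrite ord1 [RHS]mxE eqxx mulr1n /q dotC mxE.
    by apply: eq_bigr => j _; rewrite [p^T _ _]mxE.
  by rewrite mul_scalar_mx dotZl -/q; ring.
rewrite dotZl -/q -/N.
have errc := ler_wpM2l (ltW c0) err.
have e'N := ler_wpM2r N0 e'e; have etaN := ler_wpM2r N0 etaG.
rewrite /r /G in errc etaN *; lra.
Qed.

End ExpJet.

(** * Sup-convolution *)

Section SupConvolution.
Context (R : realType) (n : nat).
Implicit Types (z w zeta : 'rV[R]_n * R) (p h : 'rV[R]_n) (a kappa : R).
Implicit Types (U A : 'rV[R]_n * R -> R) (K : set ('rV[R]_n * R)).

(** The space-time slopes at [z] of a semiconvex function: those of the
    paraboloids of opening [kappa] supporting its graph from below. *)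
Definition lower_tangent U kappa z p a :=
  forall w, U z + dot p (w.1 - z.1) + a * (w.2 - z.2) - kappa * sqdist w z
            <= U w.

Definition is_supconv K A kappa U (opt : 'rV[R]_n * R -> 'rV[R]_n * R) :=
  forall z, [/\ K (opt z), U z = A (opt z) - kappa * sqdist z (opt z)
    & forall zeta, K zeta -> A zeta - kappa * sqdist z zeta <= U z].

Lemma supconv_exists K A kappa : K !=set0 -> compact K -> usc_on K A ->
  exists U opt, is_supconv K A kappa U opt.
Proof.
move=> K0 cK uA.
have /choice[f fP] : forall z, exists o, K o /\ forall zeta, K zeta ->
    A zeta - kappa * sqdist z zeta <= A o - kappa * sqdist z o.
  move=> z; have uz : usc_on K (fun zeta => A zeta + - kappa * sqdist z zeta).
    apply: usc_onD => //; apply: continuous_usc_on => zeta.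
    apply: cvgM; first exact: cvg_cst.
    by apply: continuous_sqdist => ?; [exact: cvg_cst|exact: cvg_id].
  have [m Km mmax] := usc_max K0 cK uz; exists m; split=> // zeta /mmax.
  by rewrite !mulNr.
exists (fun z => A (f z) - kappa * sqdist z (f z)), f => z.
by have [Ko omax] := fP z; split.
Qed.

(** The downward paraboloid of the kernel centred at [opt z] lies below [U]. *)
Lemma supconv_lower_tangent K A kappa U opt z : is_supconv K A kappa U opt ->
  exists p a, lower_tangent U kappa z p a.
Proof.
move=> UP; have [Ko Uz _] := UP z.
exists ((2 * kappa) *: ((opt z).1 - z.1)), (2 * kappa * ((opt z).2 - z.2)) => w.
have [_ _ /(_ _ Ko)] := UP w; apply: le_trans; rewrite Uz /sqdist.
have -> : w.1 - (opt z).1 = (w.1 - z.1) - ((opt z).1 - z.1).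
  by rewrite opprB addrA subrK.
rewrite -(dotB_sym (opt z).1).
move: ((opt z).1 - z.1) (w.1 - z.1) => k h.
by rewrite !dotE (dotC k h); lra.
Qed.

(** By compactness of [K] the kernel is continuous in its first argument
    uniformly with respect to the second. *)
Lemma supconv_continuous K A kappa U opt : compact K ->
  is_supconv K A kappa U opt -> continuous U.
Proof.
move=> /compact_near_coveringP cK UP z0; apply/cvgrPdist_lt => e e0.
pose P z zeta := `|kappa * sqdist z0 zeta - kappa * sqdist z zeta| < e.
have : \forall z \near z0, K `<=` P z.
  apply: (cK _ (nbhs z0) P) => zeta _.
  pose g (y : ('rV[R]_n * R) * ('rV[R]_n * R)) :=
    kappa * sqdist z0 y.1 - kappa * sqdist y.2 y.1.
  have cg : continuous g.
    have c1 : continuous (fst : ('rV[R]_n * R) * ('rV[R]_n * R) -> _).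
      by move=> y; exact: cvg_fst.
    have c2 : continuous (snd : ('rV[R]_n * R) * ('rV[R]_n * R) -> _).
      by move=> y; exact: cvg_snd.
    move=> y; apply: cvgB; apply: cvgM; try exact: cvg_cst.
      by apply: (continuous_sqdist _ c1) => ?; exact: cvg_cst.
    exact: (continuous_sqdist c2 c1).
  have /cvgrPdist_lt /(_ e e0) := cg (zeta, z0).
  apply: filterS => -[zeta' z]; rewrite /g /P /= subrr.
  by rewrite sub0r normrN.
apply: filterS => z near_z.
have [Ko Uz Umax] := UP z; have [Ko0 Uz0 Umax0] := UP z0.
have := Umax _ Ko0; have := Umax0 _ Ko; rewrite Uz Uz0.
have := near_z _ Ko; have := near_z _ Ko0; rewrite /P !ltr_norml.
move=> /andP[? ?] /andP[? ?] ? ?.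
by apply/andP; split; lra.
Qed.

(** Translating a test function of [U] from [z] to the point [opt z] where the
    maximum is attained gives a test function of [A]. *)
Lemma supconv_upper_jet K A kappa U opt z a p X :
  is_supconv K A kappa U opt -> upper_jet setT U z a p X ->
  upper_jet K A (opt z) a p X.
Proof.
move=> UP jet e /(jet e)/nbhs_sqdist[rho rho0 Urho].
apply/nbhs_sqdist; exists rho => // w wo Kw; set o := opt z in wo *.
pose z' := (z.1 + (w.1 - o.1), z.2 + (w.2 - o.2)).
have z'1 : z'.1 - z.1 = w.1 - o.1 by rewrite /= addrC addKr.
have z'2 : z'.2 - z.2 = w.2 - o.2 by rewrite /= addrC addKr.
have := Urho z'; rewrite {1}/sqdist z'1 z'2 => /(_ wo I).
have [Ko Uz _] := UP z; have [_ _ /(_ _ Kw)] := UP z'.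
have -> : sqdist z' w = sqdist z o.
  rewrite /sqdist /=; congr (dot _ _ + _ ^+ 2); last by ring.
    by rewrite -addrA (addrAC w.1) subrr add0r.
  by rewrite -addrA (addrAC w.1) subrr add0r.
rewrite Uz -/o; lra.
Qed.

Lemma small_scale (C : R) : 0 <= C -> exists2 t, 0 < t <= 1 & t * C < 1.
Proof.
move=> C0; exists (1 + C)^-1; last by rewrite mulrC ltr_pdivrMr ?mul1r; lra.
by rewrite invr_gt0 invf_le1; lra.
Qed.

(** The slopes are determined by restricting both inequalities to a line in
    space and to the time axis and letting the increment tend to zero. *)
Lemma lower_tangent_upper_jet U kappa z p a q b X : 0 <= kappa ->
  lower_tangent U kappa z p a -> upper_jet setT U z b q X -> p = q /\ a = b.
Proof.
move=> k0 low jet; split; apply/eqP; rewrite -subr_eq0; apply/negPn/negP => v0.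
  have [C C0 XC] := dot_mulmx_bound X; set v := p - q in v0.
  have vv0 : 0 < dot v v by rewrite dot_gt0.
  have /nbhs_sqdist[rho rho0 near_z] := jet 1 ltr01.
  have [t /andP[t0 t1] tC] := small_scale (addr_ge0 (divr_ge0 (ltW vv0) (ltW rho0))
    (addr_ge0 k0 (addr_ge0 C0 ler01))).
  pose w := (z.1 + t *: v, z.2).
  have w1 : w.1 - z.1 = t *: v by rewrite /= addrC addKr.
  have w2 : w.2 - z.2 = 0 by rewrite /= subrr.
  have tC' := mulr_ge0 (ltW t0) C0.
  have tk' := mulr_ge0 (ltW t0) k0.
  have tv : t * (dot v v / rho) < 1 by move: tC; rewrite !mulrDr mulr1; lra.
  have := near_z w; have := low w; rewrite /sqdist w1 w2 expr0n /= addr0.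
  rewrite -scalemxAl normr0 !dotZl !dotZr => loww /(_ _ I) jetw.
  rewrite mulrA in tv; move: tv; rewrite ltr_pdivrMr// mul1r => tv.
  have ttv : t * (t * dot v v) < rho.
    by apply: le_lt_trans tv; rewrite ler_piMl// mulr_ge0 ?ltW.
  have := jetw ttv; have := XC v; rewrite ler_norml => /andP[_ Xv].
  have : t * dot v v = t * dot p v - t * dot q v by rewrite /v !dotE; ring.
  have {}Xv : t * (t * dot (v *m X) v) <= t * (t * (C * dot v v)).
    by rewrite !ler_wpM2l// ltW.
  have k2 : t * (t * (kappa + C + 1)) * dot v v < t * dot v v.
    rewrite ltr_pM2r// -[ltRHS]mulr1 ltr_pM2l//; move: tC; rewrite !mulrDr mulr1.
    have : 0 <= t * (dot v v / rho) by rewrite mulr_ge0 ?divr_ge0 ?ltW.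
    lra.
  have := mulr_ge0 (ltW t0) (mulr_ge0 (ltW t0) (mulr_ge0 C0 (ltW vv0))).
  lra.
set v := a - b in v0.
have vv0 : 0 < `|v| by rewrite normr_gt0.
have v20 : 0 < v ^+ 2 by rewrite exprn_even_gt0.
have /nbhs_sqdist[rho rho0 near_z] := jet (`|v| / 4) (divr_gt0 vv0 (ltr0Sn _ _)).
have [t /andP[t0 t1] tC] := small_scale (addr_ge0 (divr_ge0 (ltW v20) (ltW rho0))
  (mulr_ge0 (ler0n _ 2) k0)).
pose w := (z.1, z.2 + t * v).
have w1 : w.1 - z.1 = 0 by rewrite /= subrr.
have w2 : w.2 - z.2 = t * v by rewrite /= addrC addKr.
have tk' := mulr_ge0 (ltW t0) k0.
have tv : t * (v ^+ 2 / rho) < 1 by move: tC; rewrite mulrDr; lra.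
have := near_z w; have := low w; rewrite /sqdist w1 w2 mul0mx !dot0r mulr0 !(add0r, addr0).
rewrite normrM (gtr0_norm t0) => loww /(_ _ I) jetw.
rewrite mulrA in tv; move: tv; rewrite ltr_pdivrMr// mul1r => tv.
have ttv : (t * v) ^+ 2 < rho.
  by apply: le_lt_trans tv; rewrite exprMn expr2 -mulrA ler_piMl// mulr_ge0 ?ltW.
have := jetw ttv.
have -> : `|v| / 4 * (t * `|v|) = t * v ^+ 2 / 4.
  by rewrite -(real_normK (num_real v)); field.
have k2 : t * (2 * kappa) * (t * v ^+ 2) < t * v ^+ 2.
  rewrite -[ltRHS]mul1r (ltr_pM2r (mulr_gt0 t0 v20)); move: tC; rewrite mulrDr.
  have : 0 <= t * (v ^+ 2 / rho) by rewrite mulr_ge0 ?divr_ge0 ?ltW.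
  lra.
have : t * v ^+ 2 = a * (t * v) - b * (t * v) by rewrite /v; ring.
have := mulr_gt0 t0 v20.
rewrite exprMn in loww.
lra.
Qed.

End SupConvolution.

(** * Cones as test functions *)

Section Cones.
Context (R : realType) (n : nat).
Implicit Types (x y h p d : 'rV[R]_n) (z w : 'rV[R]_n * R).

Definition enorm x := Num.sqrt (dot x x).

Lemma enorm_ge0 x : 0 <= enorm x.
Proof. exact: sqrtr_ge0. Qed.

Lemma enorm_sqr x : enorm x ^+ 2 = dot x x.
Proof. by rewrite sqr_sqrtr ?dot_ge0. Qed.

Lemma enorm_le r x : 0 <= r -> (enorm x <= r) = (dot x x <= r ^+ 2).
Proof. by move=> r0; rewrite -ler_sqr ?nnegrE ?enorm_ge0// enorm_sqr. Qed.

Lemma dot_mul_outer x y d : dot (x *m (d^T *m d)) y = dot x d * dot d y.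
Proof.
rewrite mulmxA; have -> : x *m d^T = (dot x d)%:M.
  apply/rowP => i; rewrite ord1 [RHS]mxE eqxx mulr1n mxE.
  by apply: eq_bigr => j _; rewrite [d^T _ _]mxE.
by rewrite mul_scalar_mx dotZl.
Qed.

(** Write |d + h|^2 as D^2 plus the square of the part of [h] orthogonal to [d],
    where D is the first-order expansion of |d + h|, and use the inequality
    sqrt (D^2 + s) <= D + s / (2 D). The conclusion has no second-order term
    along [d], which is what makes cones good test functions here. *)
Lemma enorm_expansion d e : d != 0 -> 0 < e ->
  exists2 rho, 0 < rho & forall h, dot h h < rho ->
    enorm (d + h) <= enorm d + dot d h / enorm d
      + (dot h h - (dot d h / enorm d) ^+ 2) / (2 * enorm d) + e * dot h h.
Proof.
move=> d0 e0; set r := enorm d.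
have r0 : 0 < r by rewrite sqrtr_gt0 dot_gt0.
have rr : dot d d = r ^+ 2 by rewrite enorm_sqr.
pose b := Num.min (r / 2) (e * r ^+ 2).
have b0 : 0 < b by rewrite lt_min divr_gt0// mulr_gt0// exprn_gt0.
exists (b ^+ 2); first by rewrite exprn_gt0.
move=> h hb; set hh := dot h h in hb *; have hh0 : 0 <= hh := dot_ge0 h.
have : dot d h ^+ 2 <= r ^+ 2 * hh by rewrite -rr; exact: cauchy_schwarz.
have -> : dot d h = dot d h / r * r by field; rewrite gt_eqF.
have -> : dot d h / r * r / r = dot d h / r by field; rewrite gt_eqF.
set m := dot d h / r => mhh.
have {}mhh : m ^+ 2 <= hh.
  by move: mhh; rewrite exprMn mulrC ler_pM2l// exprn_gt0.
have mb : `|m| <= b.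
  by rewrite -ler_sqr ?nnegrE ?(ltW b0)// real_normK ?num_real//; lra.
have [mr mer] : `|m| <= r / 2 /\ `|m| <= e * r ^+ 2.
  by move: mb; rewrite /b le_min => /andP[].
pose D := r + m; have Dr : r / 2 <= D.
  by move: mr; rewrite ler_norml /D => /andP[]; lra.
have D0 : 0 < D by apply: lt_le_trans Dr; rewrite divr_gt0.
have sq : dot (d + h) (d + h) = D ^+ 2 + (hh - m ^+ 2).
  rewrite !dotE (dotC h d) rr -/hh /D.
  have -> : dot d h = m * r by rewrite /m; field; rewrite gt_eqF.
  by ring.
have step1 : enorm (d + h) <= D + (hh - m ^+ 2) / (2 * D).
  rewrite enorm_le; last by rewrite addr_ge0 ?divr_ge0 ?mulr_ge0 ?subr_ge0 ?(ltW D0).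
  rewrite sq -subr_ge0.
  have -> : (D + (hh - m ^+ 2) / (2 * D)) ^+ 2 - (D ^+ 2 + (hh - m ^+ 2)) =
     ((hh - m ^+ 2) / (2 * D)) ^+ 2 by field; rewrite gt_eqF.
  exact: sqr_ge0.
apply: le_trans step1 _; rewrite -[leRHS]addrA -/D lerD2l -lerBlDl.
have -> : (hh - m ^+ 2) / (2 * D) - (hh - m ^+ 2) / (2 * r) =
   (hh - m ^+ 2) * (- m / (2 * D * r)).
  by rewrite /D; field; rewrite -/D !gt_eqF.
rewrite mulrC; apply: (@le_trans _ _ (e * (hh - m ^+ 2))); last first.
  by rewrite ler_wpM2l ?(ltW e0)// gerBl sqr_ge0.
rewrite ler_wpM2r ?subr_ge0// ler_pdivrMr ?mulr_gt0//.
move: mer; rewrite ler_norml => /andP[mer _].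
have : e * r ^+ 2 <= e * (2 * D * r) by rewrite ler_pM2l// expr2 ler_pM2r//; lra.
lra.
Qed.

Definition radial (s k r : R) := s * r + k / 2 * r ^+ 2.

(** The Hessian of a radial function acts on the gradient as its radial second
    derivative [k]: the curvature of the spheres does not contribute. *)
Lemma radial_upper_jet (U : 'rV[R]_n * R -> R) z x1 t1 (s k L : R) :
  0 <= s -> z.1 != x1 ->
  (\forall w \near z, U w <= U z + radial s k (enorm (w.1 - x1))
      - radial s k (enorm (z.1 - x1))
      + L * ((w.2 - t1) ^+ 2 - (z.2 - t1) ^+ 2)) ->
  exists p X, [/\ X^T = X, dot (p *m X) p = dot p p * k &
    upper_jet setT U z (2 * L * (z.2 - t1)) p X].
Proof.
move dE : (z.1 - x1) => d s0 zx1 touch.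
have d0 : d != 0 by rewrite -dE subr_eq0.
set r := enorm d; have r0 : 0 < r by rewrite sqrtr_gt0 dot_gt0.
have rr : dot d d = r ^+ 2 by rewrite enorm_sqr.
exists ((s / r + k) *: d), ((s / r + k)%:M - (s / r ^+ 3) *: (d^T *m d)); split.
- by rewrite linearB/= tr_scalar_mx linearZ/= trmx_mul trmxK.
- rewrite mulmxBr mul_mx_scalar -scalemxAr !dotE dot_mul_outer !dotE rr.
  by field; rewrite gt_eqF.
move=> e e0.
have e10 : 0 < e / (1 + s) by rewrite divr_gt0// ltr_wpDr.
have [rho rho0 nexp] := enorm_expansion d0 e10.
have near_z : \forall w \near z, sqdist w z < rho.
  by apply/nbhs_sqdist; exists rho.
apply: filterS3 near_z (time_sqr_small z L e0) touch => w wz Ltau Uw _.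
apply: le_trans Uw _; move: wz Ltau.
have -> : w.1 - x1 = d + (w.1 - z.1) by rewrite -dE [RHS]addrC addrA subrK.
rewrite /sqdist; move: (w.1 - z.1) => h; set tau := w.2 - z.2.
have -> : w.2 - t1 = z.2 - t1 + tau by rewrite /tau; ring.
have hh0 := dot_ge0 h; set hh := dot h h in hh0 *.
move=> hrho Ltau.
have /nexp : dot h h < rho by rewrite -/hh; have := sqr_ge0 tau; lra.
rewrite -/r -/hh => dh.
have sq : enorm (d + h) ^+ 2 = r ^+ 2 + 2 * dot d h + hh.
  by rewrite enorm_sqr !dotE (dotC h d) rr -/hh; ring.
have se : s * (e / (1 + s) * hh) <= e * hh.
  rewrite mulrA; apply: ler_wpM2r => //.
  by rewrite mulrA ler_pdivrMr ?ltr_wpDr// mulrC ler_wpM2l ?(ltW e0)// lerDr.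
have sdh := ler_wpM2l s0 dh.
rewrite mulmxBr mul_mx_scalar -scalemxAr dotDl dotNl !dotZl dot_mul_outer -/hh.
rewrite (dotC h d) /radial sq mulrDr.
have -> : s / r ^+ 3 * (dot d h * dot d h) =
    s * ((dot d h / r) ^+ 2 / r) by field; rewrite gt_eqF.
have -> : (s / r + k) * dot d h = s * (dot d h / r) + k * dot d h.
  by field; rewrite gt_eqF.
have -> : (s / r + k) * hh = s * (hh / r) + k * hh by field; rewrite gt_eqF.
move: sdh; have -> : (hh - (dot d h / r) ^+ 2) / (2 * r) =
    2^-1 * (hh / r) - 2^-1 * ((dot d h / r) ^+ 2 / r) by field; rewrite gt_eqF.
lra.
Qed.

End Cones.

(** * The midpoint inequality *)

Section Compactness.
Context (R : realType) (n : nat).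

Lemma compact_dot_ball (x1 : 'rV[R]_n) (c : R) :
  compact [set y : 'rV[R]_n | dot (y - x1) (y - x1) <= c].
Proof.
have cd : continuous (fun y : 'rV[R]_n => dot (y - x1) (y - x1)).
  have cB : continuous (fun y : 'rV[R]_n => y - x1).
    move=> y; have : {for y, continuous ((fun x : 'rV[R]_n => x) - cst x1)}.
      by apply: (@continuousB R); [move=> A; exact|exact: cst_continuous].
    exact.
  exact: (continuous_dot cB cB).
apply: (@subclosed_compact _ _ [set v : 'rV[R]_n |
  forall i, `[x1 0 i - (c + 1), x1 0 i + (c + 1)]%classic (v ord0 i)]).
- have := @closed_comp _ _ (fun y : 'rV[R]_n => dot (y - x1) (y - x1))
    [set r | r <= c] (fun y _ => cd y) (@closed_le _ c).
  exact.
- apply: (@rV_compact R n (fun i => `[x1 0 i - (c + 1), x1 0 i + (c + 1)]%classic)).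
  by move=> i; exact: segment_compact.
- move=> y /= yc i; have := coord_sqr_le_dot (y - x1) i; rewrite !mxE in_itv /=.
  have s1 := sqr_ge0 (y ord0 i - x1 ord0 i - 1).
  have s2 := sqr_ge0 (y ord0 i - x1 ord0 i + 1).
  have c0 : 0 <= c by apply: le_trans yc; exact: dot_ge0.
  by move=> yi; apply/andP; split; lra.
Qed.

End Compactness.

Section Midpoint.
Context (R : realType) (n : nat).
Implicit Types (x y h p : 'rV[R]_n) (z w : 'rV[R]_n * R) (a b k r : R).

Lemma paraboloid_upper_jet (U : 'rV[R]_n * R -> R) kappa z p a :
  (\forall w \near z, U w <= U z + dot p (w.1 - z.1) + a * (w.2 - z.2)
     + kappa * sqdist w z) ->
  upper_jet setT U z a p (2 * kappa)%:M.
Proof.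
move=> touch e e0; apply: filterS2 (time_sqr_small z kappa e0) touch.
move=> w ktau Uw _; apply: le_trans Uw _.
rewrite /sqdist mul_mx_scalar dotZl.
have := mulr_ge0 (ltW e0) (dot_ge0 (w.1 - z.1)); lra.
Qed.

(** If the slopes at [z] and [z0] differ by a vector of length [l], following
    it from [z] for a distance [d] makes the lower paraboloid of [z] exceed the
    upper one of [z0] by about [l * d], up to an error of order
    [kappa * (d ^+ 2 + sqdist z z0)]. Taking [d] comparable to the distance from
    [z] to [z0] bounds [l] by a multiple of that distance. *)
Lemma lower_tangent_continuous (U : 'rV[R]_n * R -> R) kappa z0 p0 b0
    (P : set ('rV[R]_n * R)) :
  0 <= kappa -> lower_tangent U kappa z0 p0 b0 ->
  (\forall w \near z0, U w <= U z0 + dot p0 (w.1 - z0.1) + b0 * (w.2 - z0.2)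
     + kappa * sqdist w z0) ->
  nbhs (p0, b0) P ->
  \forall z \near z0, forall p a, lower_tangent U kappa z p a -> P (p, a).
Proof.
move=> k0 low0 /nbhs_sqdist[rho rho0 up0] /nbhs_sqdist[del del0 delP].
pose D := 4 / rho + (6 * kappa) ^+ 2 / del.
have rho40 : 0 <= 4 / rho by rewrite divr_ge0// ltW.
have kdel0 : 0 <= (6 * kappa) ^+ 2 / del by rewrite divr_ge0 ?sqr_ge0// ltW.
have D0 : 0 <= D by exact: addr_ge0.
have [t /andP[t0 t1] tD] := small_scale D0.
have mu_rho : 4 * t < rho.
  have : t * (4 / rho) < 1.
    by apply: le_lt_trans tD; rewrite ler_wpM2l ?(ltW t0)// lerDl.
  by rewrite mulrA ltr_pdivrMr// mul1r mulrC.
have mu_del : (6 * kappa) ^+ 2 * t < del.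
  have : t * ((6 * kappa) ^+ 2 / del) < 1.
    by apply: le_lt_trans tD; rewrite ler_wpM2l ?(ltW t0)// lerDr.
  by rewrite mulrA ltr_pdivrMr// mul1r mulrC.
apply/nbhs_sqdist; exists t => // z zz0 p a low; apply: delP.
rewrite ltNge; apply/negP => Q; move: Q; set Q := sqdist _ _ => Qdel.
have Q0 : 0 < Q by exact: lt_le_trans Qdel.
pose th := Num.sqrt (t / Q); have th0 : 0 < th by rewrite sqrtr_gt0 divr_gt0.
have thQ : th ^+ 2 * Q = t.
  by rewrite sqr_sqrtr ?divr_ge0 ?ltW// divfK// gt_eqF.
pose w := (z.1 + th *: (p - p0), z.2 + th * (a - b0)).
have w1 : w.1 - z.1 = th *: (p - p0) by rewrite /= addrC addKr.
have w2 : w.2 - z.2 = th * (a - b0) by rewrite /= addrC addKr.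
have wz : sqdist w z = t.
  by rewrite /sqdist w1 w2 dotZl dotZr -thQ /Q /sqdist /=; ring.
have wz0 : sqdist w z0 <= 2 * (t + sqdist z z0).
  by apply: le_trans (sqdist_triangle _ _ z) _; rewrite wz.
have := up0 w; rewrite (_ : w.1 - z0.1 = (w.1 - z.1) + (z.1 - z0.1)); last first.
  by rewrite addrA subrK.
rewrite (_ : w.2 - z0.2 = (w.2 - z.2) + (z.2 - z0.2)); last by ring.
have := low w; have := low0 z; rewrite wz w1 w2 !dotDr !dotZr => l0 lz.
have QE : Q = dot p (p - p0) - dot p0 (p - p0) + (a - b0) ^+ 2.
  by rewrite /Q /sqdist /= -dotNl -dotDl.
have kz : kappa * sqdist z z0 <= kappa * t by rewrite ler_wpM2l// ltW.
have kw : kappa * sqdist w z0 <= kappa * (4 * t).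
  by apply: ler_wpM2l => //; apply: le_trans wz0 _; lra.
have wrho : sqdist w z0 < rho by apply: le_lt_trans wz0 _; lra.
move=> /(_ wrho); rewrite QE in thQ *.
have thQle : th * Q <= 6 * kappa * t -> False.
  rewrite -thQ QE -/Q; move=> H.
  have thk : 1 <= 6 * kappa * th.
    by rewrite -(ler_pM2l (mulr_gt0 th0 Q0)); rewrite QE in H *; lra.
  have : 1 <= (6 * kappa) ^+ 2 * th ^+ 2.
    by rewrite -exprMn exprn_ege1.
  rewrite -(ler_pM2r Q0) mul1r -mulrA; rewrite QE in Qdel *; rewrite thQ.
  lra.
by move=> up; apply: thQle; rewrite QE; lra.
Qed.

End Midpoint.

Section ConeComparison.
Context (R : realType) (n : nat).
Implicit Types (x y h p : 'rV[R]_n) (z w : 'rV[R]_n * R) (a b k r s t : R).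
Implicit Types (U : 'rV[R]_n * R -> R).

(** The inequality 3 (U_t + e) <= Delta_infty U + sigma |D U|^4 at [z] in the
    viscosity sense: [sigma = 1] for ln u, [sigma = -1] for - ln v. *)
Definition visc_on (K : set ('rV[R]_n * R)) U (sigma e : R) z :=
  forall a p X, X^T = X -> upper_jet K U z a p X ->
    3 * (a + e) <= dot (p *m X) p + sigma * dot p p ^+ 2.

Lemma continuous_spaceB (x1 : 'rV[R]_n) :
  continuous (fun w : 'rV[R]_n * R => w.1 - x1).
Proof.
move=> w; have : {for w, continuous ((fst : 'rV[R]_n * R -> _) - cst x1)}.
  by apply: (@continuousB R); [exact: cvg_fst|exact: cst_continuous].
exact.
Qed.

Lemma continuous_timeB (t1 : R) :
  continuous (fun w : 'rV[R]_n * R => w.2 - t1).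
Proof. by move=> w; apply: cvgB; [exact: cvg_snd|exact: cvg_cst]. Qed.

Lemma continuous_enorm (T : topologicalType) (f : T -> 'rV[R]_n) :
  continuous f -> continuous (fun u => enorm (f u)).
Proof.
move=> cf u.
apply: (@cvg_comp _ _ _ (fun v => dot (f v) (f v)) (@Num.sqrt R)).
  exact: (continuous_dot cf cf).
exact: sqrt_continuous.
Qed.

(** A violation on the slice would produce, after penalizing the time variable
    strongly, an interior maximum of [U] minus the cone away from its vertex,
    where the cone is an admissible test function with radial second derivative
    [k]; this contradicts the strict inequality assumed of the slopes. *)
Lemma cone_comparison U kappa sigma e k s x1 t1 (d h L : R) :
  0 <= kappa -> continuous U ->
  (forall z, exists p a, lower_tangent U kappa z p a) ->
  0 <= s -> 0 < d -> 0 < h ->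
  (forall y t, dot (y - x1) (y - x1) <= d ^+ 2 -> `|t - t1| <= h ->
     visc_on setT U sigma e (y, t) /\
     forall p a, lower_tangent U kappa (y, t) p a ->
       `|a| <= L /\ dot p p * k + sigma * dot p p ^+ 2 < 3 * (a + e)) ->
  (forall y, dot (y - x1) (y - x1) <= d ^+ 2 ->
     U (y, t1) <= U (x1, t1) + radial s k d) ->
  forall y, dot (y - x1) (y - x1) <= d ^+ 2 ->
    U (y, t1) <= U (x1, t1) + radial s k (enorm (y - x1)).
Proof.
move=> k0 cU tanU s0 d0 h0 region bdry y0 y0d.
rewrite leNgt; apply/negP => viol.
pose gam := U (y0, t1) - U (x1, t1) - radial s k (enorm (y0 - x1)).
have gam0 : 0 < gam by rewrite /gam; lra.
have L0 : 0 <= L.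
  have [p [a low]] := tanU (y0, t1).
  have [|_ /(_ _ _ low)[aL _]] := region y0 t1 y0d; first by rewrite subrr normr0 ltW.
  exact: le_trans aL.
pose D := L / h + L ^+ 2 / gam + 1.
have Lh0 : 0 <= L / h by rewrite divr_ge0 ?(ltW h0).
have Lg0 : 0 <= L ^+ 2 / gam by rewrite divr_ge0 ?sqr_ge0 ?(ltW gam0).
have D0 : 0 < D by rewrite /D; lra.
have LDh : L < D * h by rewrite -ltr_pdivrMr// /D; lra.
have LDg : L ^+ 2 < D * gam by rewrite -ltr_pdivrMr// /D; lra.
(* The penalization [Lam] makes the time [ts] of the maximum close to [t1]:
   both [L / D] and [L ^+ 2 / D] have to be small. *)
pose Lam := kappa + D.
pose Phi w := U w - radial s k (enorm (w.1 - x1)) - Lam * (w.2 - t1) ^+ 2.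
have cn : continuous (fun w : 'rV[R]_n * R => enorm (w.1 - x1)).
  by apply: continuous_enorm; exact: continuous_spaceB.
have cPhi : continuous Phi.
  move=> w; apply: cvgB; first apply: cvgB; first exact: cU.
    apply: cvgD; first by apply: cvgM; [exact: cvg_cst|exact: cn].
    by apply: cvgM; [exact: cvg_cst|apply: cvgM; exact: cn].
  by apply: cvgM; [exact: cvg_cst|apply: cvgM; exact: continuous_timeB].
pose K := [set y | dot (y - x1) (y - x1) <= d ^+ 2] `*`
  `[t1 - h, t1 + h]%classic.
have inK y t : dot (y - x1) (y - x1) <= d ^+ 2 -> `|t - t1| <= h -> K (y, t).
  by move=> yd; rewrite ler_norml => /andP[? ?]; split=> //=; rewrite in_itv /=; lra.
have [||[ys ts] /= Kz zmax] := usc_max _ _ (@continuous_usc_on _ _ K _ cPhi).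
- by exists (y0, t1); apply: inK => //; rewrite subrr normr0 ltW.
- by apply: compact_setX; [exact: compact_dot_ball|exact: segment_compact].
have [ysd tsh] : dot (ys - x1) (ys - x1) <= d ^+ 2 /\ `|ts - t1| <= h.
  case: Kz => /= ysd; rewrite in_itv /= => /andP[? ?]; split=> //.
  by rewrite ler_norml; apply/andP; split; lra.
have t1K : `|t1 - t1| <= h by rewrite subrr normr0 ltW.
have := zmax _ (inK _ _ y0d t1K); have := zmax _ (inK _ _ ysd t1K).
rewrite /Phi /= subrr expr0n /= mulr0 !subr0 => max1.
have -> : U (y0, t1) - radial s k (enorm (y0 - x1)) = U (x1, t1) + gam.
  by rewrite /gam; ring.
move=> max0.
have [visc slopes] := region _ _ ysd tsh.
have [p [a low]] := tanU (ys, ts); have [aL strict] := slopes _ _ low.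
have := low (ys, t1); rewrite /sqdist /= subrr dot0r dot0l addr0 add0r.
set del := `|ts - t1| in tsh => lowt.
have del0 : 0 <= del by exact: normr_ge0.
have del2 : (ts - t1) ^+ 2 = del ^+ 2 by rewrite real_normK ?num_real.
have del2' : (t1 - ts) ^+ 2 = del ^+ 2 by rewrite -del2; ring.
have adel : - (L * del) <= a * (t1 - ts).
  have : `|a * (t1 - ts)| <= L * del by rewrite normrM distrC ler_wpM2r.
  by rewrite ler_norml => /andP[].
rewrite del2' in lowt; rewrite del2 in max0 max1.
have Ddel : D * del <= L.
  have : D * del * del <= L * del by rewrite /Lam in max1; lra.
  have [->|dn0] := eqVneq del 0; first by rewrite !mulr0.
  by rewrite ler_pM2r// lt_def dn0.
have Ldel : L * del < gam.
  rewrite -(ltr_pM2l D0); apply: le_lt_trans LDg.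
  by rewrite mulrCA expr2 ler_wpM2l.
have delh : del < h by rewrite -(ltr_pM2l D0); exact: le_lt_trans LDh.
have D2 : 0 <= D * del ^+ 2 by rewrite mulr_ge0 ?sqr_ge0 ?(ltW D0).
have above : U (x1, t1) < U (ys, t1) - radial s k (enorm (ys - x1)).
  by rewrite /Lam in max0; lra.
have ysx1 : ys != x1.
  apply/eqP => ysE; move: above; rewrite ysE subrr /enorm dot0l sqrtr0.
  by rewrite /radial expr0n /= !mulr0 addr0 subr0 ltxx.
have {}ysd : dot (ys - x1) (ys - x1) < d ^+ 2.
  rewrite lt_neqAle ysd andbT; apply/eqP => ysE.
  have := bdry ys; rewrite ysE lexx => /(_ isT).
  move: above; rewrite /enorm ysE sqrtr_sqr gtr0_norm//; lra.
have near_z : \forall w \near (ys, ts), Phi w <= Phi (ys, ts).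
  have n1 : \forall w \near (ys, ts), dot (w.1 - x1) (w.1 - x1) < d ^+ 2.
    have cd := continuous_dot (@continuous_spaceB x1) (@continuous_spaceB x1).
    exact: (cvgr_lt _ (cd (ys, ts))).
  have n2 : \forall w \near (ys, ts), `|w.2 - t1| < h.
    exact: (cvgr_lt _ (cvg_norm (@continuous_timeB t1 (ys, ts)))).
  apply: filterS2 n1 n2 => -[y t] /= yd th.
  by apply: zmax; apply: inK; exact: ltW.
have [|q [X [XT qX jet]]] := @radial_upper_jet _ _ U (ys, ts) x1 t1 s k Lam s0 ysx1.
  by apply: filterS near_z => w; rewrite /Phi /=; lra.
have [pq ab] := lower_tangent_upper_jet k0 low jet.
have := visc _ _ _ XT jet; rewrite qX -pq -ab; move: strict; lra.
Qed.

End ConeComparison.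

Section MidpointEstimate.
Context (R : realType) (n : nat).
Implicit Types (x y h p : 'rV[R]_n) (z w : 'rV[R]_n * R) (a b k r s t : R).
Implicit Types (U : 'rV[R]_n * R -> R).

(** Let [y3] maximize [U] on the ball of radius [2 * r] of the time slice and let
    the slope at the vertex of the cone be such that the cone reaches
    [U (y3, t1)] at distance [2 * r]. The cone then dominates [U] on the ball,
    and at distance [r] it takes the value of the right-hand side. It increases
    up to there because the slopes of [U] near [z0] stay away from zero, so that
    [U (y3, t1) - U (x1, t1)] is at least of order [r]. *)
Lemma midpoint_estimate U kappa sigma e z0 p0 b0 k :
  0 <= kappa -> continuous U ->
  (forall z, exists p a, lower_tangent U kappa z p a) ->
  lower_tangent U kappa z0 p0 b0 ->
  (\forall w \near z0, U w <= U z0 + dot p0 (w.1 - z0.1) + b0 * (w.2 - z0.2)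
     + kappa * sqdist w z0) ->
  (\forall z \near z0, visc_on setT U sigma e z) ->
  p0 != 0 -> dot p0 p0 * k + sigma * dot p0 p0 ^+ 2 < 3 * (b0 + e) ->
  exists2 rho, 0 < rho & forall x1 t1 r y1,
    sqdist (x1, t1) z0 < rho -> 0 < r -> r ^+ 2 < rho ->
    dot (y1 - x1) (y1 - x1) <= r ^+ 2 ->
    exists2 y3, dot (y3 - x1) (y3 - x1) <= (2 * r) ^+ 2 &
      U (y1, t1) <= (U (x1, t1) + U (y3, t1)) / 2 - k / 2 * r ^+ 2.
Proof.
move=> k0 cU tanU low0 up0 visc p00 strict0.
pose c0 := enorm p0 / 2.
have c00 : 0 < c0 by rewrite divr_gt0// sqrtr_gt0 dot_gt0.
have c0E : c0 ^+ 2 = dot p0 p0 / 4 by rewrite /c0 expr_div_n enorm_sqr; field.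
(* What is required of the slopes near [z0], an open condition. *)
pose P := [set q : 'rV[R]_n * R | [/\ c0 ^+ 2 < dot q.1 q.1, `|q.2| < `|b0| + 1 &
  dot q.1 q.1 * k + sigma * dot q.1 q.1 ^+ 2 - 3 * (q.2 + e) < 0]].
have nbhsP : nbhs (p0, b0) P.
  have c1 : continuous (fst : 'rV[R]_n * R -> _) by move=> ?; exact: cvg_fst.
  have c2 : continuous (snd : 'rV[R]_n * R -> _) by move=> ?; exact: cvg_snd.
  have cd := continuous_dot c1 c1.
  have p0c : c0 ^+ 2 < dot p0 p0 by have := exprn_gt0 2 c00; rewrite c0E; lra.
  have n1 := cvgr_gt _ (cd (p0, b0)) _ p0c.
  have n2 := cvgr_lt _ (cvg_norm (c2 (p0, b0))) (`|b0| + 1).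
  have cs : (fun q : 'rV[R]_n * R => dot q.1 q.1 * k + sigma * dot q.1 q.1 ^+ 2
      - 3 * (q.2 + e)) @ (p0, b0) -->
      dot p0 p0 * k + sigma * dot p0 p0 ^+ 2 - 3 * (b0 + e).
    apply: cvgB; [apply: cvgD|].
    - by apply: cvgM; [exact: (cd (p0, b0))|exact: cvg_cst].
    - by apply: cvgM; [exact: cvg_cst|apply: cvgM; exact: (cd (p0, b0))].
    - apply: cvgM; first exact: cvg_cst.
      by apply: cvgD; [exact: (c2 (p0, b0))|exact: cvg_cst].
  have n3 := cvgr_lt _ cs 0.
  near=> q; split.
  - by near: q; exact: n1.
  - by near: q; apply: n2; rewrite ltrDl.
  - by near: q; apply: n3; rewrite subr_lt0.
have slopes := lower_tangent_continuous k0 low0 up0 nbhsP.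
have /nbhs_sqdist[rho0 rho00 good] : \forall z \near z0, visc_on setT U sigma e z /\
    forall p a, lower_tangent U kappa z p a -> P (p, a).
  by apply: filterS2 visc slopes.
pose M := 2 * kappa + `|k|; have M0 : 0 <= M by rewrite addr_ge0 ?mulr_ge0.
have M1 : 0 < 1 + M by rewrite ltr_wpDr.
exists (Num.min (rho0 / 16) ((c0 / (1 + M)) ^+ 2)).
  by rewrite lt_min; apply/andP; split; [|apply: exprn_gt0]; exact: divr_gt0.
move=> x1 t1 r y1; rewrite !lt_min => /andP[z1rho _] r0 /andP[rrho rM] y1r.
have {}rM : (1 + M) * r < c0.
  have cM0 : 0 < c0 / (1 + M) by exact: divr_gt0.
  move: rM; rewrite ltr_sqr ?nnegrE ?(ltW r0) ?(ltW cM0)//.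
  by rewrite ltr_pdivlMr// mulrC.
have krM : 2 * kappa * r + `|k| * r <= c0 by move: rM; rewrite /M; lra.
have r2 : 0 < 2 * r by rewrite mulr_gt0.
have region y t : dot (y - x1) (y - x1) <= (2 * r) ^+ 2 -> `|t - t1| <= r ->
    sqdist (y, t) z0 < rho0.
  move=> yr tr; apply: le_lt_trans (sqdist_triangle _ _ (x1, t1)) _.
  have : (t - t1) ^+ 2 <= r ^+ 2.
    by rewrite -[leLHS]real_normK ?num_real// ler_sqr ?nnegrE ?(ltW r0).
  rewrite {1}/sqdist /=; move: yr; rewrite exprMn; lra.
have t1r : `|t1 - t1| <= r by rewrite subrr normr0 ltW.
pose B := [set y : 'rV[R]_n | dot (y - x1) (y - x1) <= (2 * r) ^+ 2].
have Bx1 : B x1 by rewrite /B /= subrr dot0l sqr_ge0.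
have [||[y3 t3] [/= y3B ->{t3}] ymax] :=
    usc_max _ _ (continuous_usc_on (K := B `*` [set t1]) cU).
- by exists (x1, t1).
- by apply: compact_setX; [exact: compact_dot_ball|exact: compact_set1].
have y3max y : B y -> U (y, t1) <= U (y3, t1) by move=> By; apply: ymax.
exists y3 => //.
pose S := U (y3, t1) - U (x1, t1).
have Sr : 2 * r * c0 - 4 * kappa * r ^+ 2 <= S.
  have [p [a low]] := tanU (x1, t1).
  have [c0p _ _] := (good _ (region _ _ Bx1 t1r)).2 _ _ low.
  have pp : c0 < enorm p.
    by rewrite -ltr_sqr ?nnegrE ?enorm_ge0 ?(ltW c00)// enorm_sqr.
  have p1 : 0 < enorm p by exact: lt_trans pp.
  (* The point at distance [2 * r] in the direction of the slope at [x1]. *)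
  pose th := 2 * r / enorm p.
  have thp : th ^+ 2 * dot p p = (2 * r) ^+ 2.
    by rewrite -enorm_sqr /th; field; rewrite gt_eqF.
  have thp' : th * dot p p = 2 * r * enorm p.
    by rewrite -enorm_sqr /th; field; rewrite gt_eqF.
  have yE : x1 + th *: p - x1 = th *: p by rewrite addrC addKr.
  have := y3max (x1 + th *: p); rewrite /B /= yE dotZl dotZr mulrA -expr2 thp.
  move=> /(_ (lexx _)); have := low (x1 + th *: p, t1).
  rewrite /sqdist /= yE subrr mulr0 expr0n /= !addr0 !dotZr !dotZl (mulrA th th).
  rewrite -expr2 thp thp'.
  have : 2 * r * c0 <= 2 * r * enorm p by rewrite ler_pM2l// ltW.
  by rewrite /S; lra.
pose s := S / (2 * r) - k * r.
have SE : S = 2 * r * (s + k * r) by rewrite /s; field; rewrite gt_eqF.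
have kr : k * r <= `|k| * r by rewrite ler_pM2r// ler_norm.
have skr : c0 - 2 * kappa * r <= s + k * r.
  by rewrite -(ler_pM2l r2) -SE; lra.
have s0 : 0 <= s by lra.
have cone := cone_comparison (U := U) (kappa := kappa) (sigma := sigma) (e := e)
  (k := k) (s := s) (x1 := x1) (t1 := t1) (d := 2 * r) (h := r) (L := `|b0| + 1)
  k0 cU tanU s0 r2 r0.
have y1B : dot (y1 - x1) (y1 - x1) <= (2 * r) ^+ 2.
  by apply: le_trans y1r _; rewrite exprMn; have := sqr_ge0 r; lra.
have {cone} : U (y1, t1) <= U (x1, t1) + radial s k (enorm (y1 - x1)).
  apply: cone => // [y t yr tr|y yr].
    have [vz sz] := good _ (region _ _ yr tr); split=> // p a /sz[_ aL st].
    by split; [exact: ltW|rewrite -subr_lt0].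
  have := y3max _ yr.
  have -> : radial s k (2 * r) = S by rewrite SE /radial; field.
  by rewrite /S; lra.
have y1r' : enorm (y1 - x1) <= r by rewrite enorm_le// ltW.
have mono : radial s k (enorm (y1 - x1)) <= radial s k r.
  have e0 := enorm_ge0 (y1 - x1); set q := enorm _ in y1r' e0 *.
  rewrite -subr_ge0 /radial.
  have -> : s * r + k / 2 * r ^+ 2 - (s * q + k / 2 * q ^+ 2) =
    (r - q) * (s + k * r - k * (r - q) / 2) by field.
  apply: mulr_ge0; first by rewrite subr_ge0.
  have : k * (r - q) <= `|k| * r.
    apply: le_trans (ler_norm _) _; rewrite normrM ler_wpM2l// ger0_norm; lra.
  have := mulr_ge0 (normr_ge0 k) (ltW r0); lra.
have -> : (U (x1, t1) + U (y3, t1)) / 2 - k / 2 * r ^+ 2 =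
    U (x1, t1) + radial s k r.
  have -> : U (y3, t1) = U (x1, t1) + S by rewrite /S; ring.
  by rewrite SE /radial; field.
lra.
Unshelve. all: by end_near. Qed.

End MidpointEstimate.

(** * Maxima of a subsolution minus a supersolution *)

Section Doubling.
Context (R : realType) (n : nat).
Implicit Types (x y h p : 'rV[R]_n) (z w : 'rV[R]_n * R) (a b k r s t : R).
Implicit Types (W V : 'rV[R]_n * R -> R).

(** At a maximum both functions are differentiable with opposite slopes. If the
    space slope vanishes, the paraboloids touching them there contradict the two
    inequalities. Otherwise the inequalities leave room for radial second
    derivatives with a positive sum, and adding the two midpoint inequalities
    improves every pair of points near [z0] at distance at most [2 * r]. *)
Lemma doubling_improves W V kappa (e : R) z0 (N : set ('rV[R]_n * R)) :
  0 <= kappa -> 0 < e -> continuous W -> continuous V ->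
  (forall z, exists p a, lower_tangent W kappa z p a) ->
  (forall z, exists p a, lower_tangent V kappa z p a) ->
  (\forall z \near z0, W z + V z <= W z0 + V z0) ->
  (\forall z \near z0, visc_on setT W 1 e z) ->
  (\forall z \near z0, visc_on setT V (-1) 0 z) ->
  nbhs z0 N ->
  exists2 rho, 0 < rho & forall y1 y2 t r,
    sqdist (y1, t) z0 < rho -> 0 < r -> r ^+ 2 < rho ->
    dot (y1 - y2) (y1 - y2) <= (2 * r) ^+ 2 ->
    exists y1' y2', [/\ N (y1', t), N (y2', t),
      dot (y1' - y2') (y1' - y2') <= (2 * r) ^+ 2 &
      W (y1, t) + V (y2, t) < W (y1', t) + V (y2', t)].
Proof.
move=> k0 e0 cW cV tanW tanV zmax viscW viscV /nbhs_sqdist[rhoN rhoN0 inN].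
have [p [b lowW]] := tanW z0; have [q [c lowV]] := tanV z0.
have upW : \forall w \near z0, W w <= W z0 + dot (- q) (w.1 - z0.1)
    + - c * (w.2 - z0.2) + kappa * sqdist w z0.
  by apply: filterS zmax => w; have := lowV w; rewrite dotNl; lra.
have upV : \forall w \near z0, V w <= V z0 + dot (- p) (w.1 - z0.1)
    + - b * (w.2 - z0.2) + kappa * sqdist w z0.
  by apply: filterS zmax => w; have := lowW w; rewrite dotNl; lra.
have jetW := paraboloid_upper_jet upW; have jetV := paraboloid_upper_jet upV.
have [pq bc] := lower_tangent_upper_jet k0 lowW jetW.
have [qp cb] := lower_tangent_upper_jet k0 lowV jetV.
rewrite -pq -bc in upW jetW; rewrite -qp -cb in upV jetV.
have [p0|p0] := eqVneq p 0.
  have := nbhs_singleton viscW _ _ _ (tr_scalar_mx _ _) jetW.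
  have := nbhs_singleton viscV _ _ _ (tr_scalar_mx _ _) jetV.
  by rewrite qp p0 oppr0 !dot0r expr0n /= !mulr0 cb; lra.
pose PP := dot p p; have PP0 : 0 < PP by rewrite dot_gt0.
have q0 : q != 0 by rewrite qp oppr_eq0.
have qq : dot q q = PP by rewrite qp dotNl dotNr opprK.
(* The inequalities allow any [k1], [k2] with [PP * k1 < 3 * (b + e) - PP ^+ 2]
   and [PP * k2 < - 3 * b + PP ^+ 2]; the gap [3 * e] is shared so that
   [k1 + k2 = e / PP]. *)
pose k1 := (3 * b + 2 * e - PP ^+ 2) / PP.
pose k2 := (- 3 * b + PP ^+ 2 - e) / PP.
have k1P : PP * k1 + 1 * PP ^+ 2 < 3 * (b + e).
  have -> : PP * k1 = 3 * b + 2 * e - PP ^+ 2 by rewrite /k1; field; rewrite gt_eqF.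
  by lra.
have k2P : dot q q * k2 + (-1) * dot q q ^+ 2 < 3 * (c + 0).
  rewrite qq cb; have -> : PP * k2 = - 3 * b + PP ^+ 2 - e.
    by rewrite /k2; field; rewrite gt_eqF.
  by lra.
have k12 : 0 < k1 + k2.
  have -> : k1 + k2 = e / PP by rewrite /k1 /k2; field; rewrite gt_eqF.
  exact: divr_gt0.
have [rho1 rho10 midW] :=
  midpoint_estimate k0 cW tanW lowW upW viscW p0 k1P.
have [rho2 rho20 midV] :=
  midpoint_estimate k0 cV tanV lowV upV viscV q0 k2P.
pose rho := Num.min (Num.min (rho1 / 4) (rho2 / 4)) (rhoN / 16).
have rho0 : 0 < rho.
  by rewrite !lt_min; apply/andP; split; [apply/andP; split|]; exact: divr_gt0.
have [r1 r2 rN] : [/\ rho <= rho1 / 4, rho <= rho2 / 4 & rho <= rhoN / 16].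
  by rewrite /rho !ge_min !lexx !orbT.
exists rho => // y1 y2 t r y1rho r0 rrho y12.
pose x1 := 2^-1 *: (y1 + y2).
have y1x : y1 - x1 = 2^-1 *: (y1 - y2).
  by apply/rowP => i; rewrite !mxE; field.
have y2x : y2 - x1 = - (2^-1 *: (y1 - y2)).
  by apply/rowP => i; rewrite !mxE; field.
have y1r : dot (y1 - x1) (y1 - x1) <= r ^+ 2.
  by rewrite y1x dotZl dotZr; move: y12; rewrite exprMn; lra.
have y2r : dot (y2 - x1) (y2 - x1) <= r ^+ 2.
  by rewrite y2x dotNl dotNr opprK dotZl dotZr; move: y12; rewrite exprMn; lra.
have x1rho : sqdist (x1, t) z0 < 4 * rho.
  apply: le_lt_trans (sqdist_triangle _ _ (y1, t)) _.
  rewrite {1}/sqdist /= subrr expr0n addr0 dotB_sym; lra.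
have nearN y : dot (y - x1) (y - x1) <= (2 * r) ^+ 2 -> N (y, t).
  move=> yr; apply: inN; apply: le_lt_trans (sqdist_triangle _ _ (x1, t)) _.
  by rewrite {1}/sqdist /= subrr expr0n addr0; move: yr; rewrite exprMn; lra.
have Nx1 : N (x1, t) by apply: nearN; rewrite subrr dot0l sqr_ge0.
have x1rho1 : sqdist (x1, t) z0 < rho1 by lra.
have x1rho2 : sqdist (x1, t) z0 < rho2 by lra.
have rrho1 : r ^+ 2 < rho1 by lra.
have rrho2 : r ^+ 2 < rho2 by lra.
have [y3 y3r Wy] := midW _ _ _ _ x1rho1 r0 rrho1 y1r.
have [y4 y4r Vy] := midV _ _ _ _ x1rho2 r0 rrho2 y2r.
have kr : 0 < (k1 + k2) * r ^+ 2 by rewrite mulr_gt0 ?exprn_gt0.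
have [lt1|le1] := ltP (W (y1, t) + V (y2, t)) (W (x1, t) + V (y4, t)).
  by exists x1, y4; split; rewrite ?(dotB_sym x1)//; exact: nearN.
exists y3, x1; split=> //; first exact: nearN.
lra.
Qed.

(** For every small [r] some pair maximizes the sum among pairs at distance at
    most [2 * r]. A limit point of such pairs as [r] tends to zero would be a
    maximum of [W + V], near which pairs can be improved; compactness in the
    form of near coverings replaces the extraction of a limit. *)
Lemma doubling_contradiction W V kappa (e : R) (B : set 'rV[R]_n) (I : set R) :
  0 <= kappa -> 0 < e -> continuous W -> continuous V ->
  (forall z, exists p a, lower_tangent W kappa z p a) ->
  (forall z, exists p a, lower_tangent V kappa z p a) ->
  compact B -> compact I -> B `*` I !=set0 ->
  (forall z0, (B `*` I) z0 ->
    (forall z, (B `*` I) z -> W z + V z <= W z0 + V z0) ->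
    [/\ nbhs z0 (B `*` I), \forall z \near z0, visc_on setT W 1 e z &
        \forall z \near z0, visc_on setT V (-1) 0 z]) ->
  False.
Proof.
move=> k0 e0 cW cV tanW tanV cB cI BI0 maxP.
have cQ : compact (B `*` I) by exact: compact_setX.
pose better r z y2 := exists z' y2', [/\ (B `*` I) z', B y2',
  dot (z'.1 - y2') (z'.1 - y2') <= (2 * r) ^+ 2 &
  W z + V (y2, z.2) < W z' + V (y2', z'.2)].
pose P r z := forall y2, dot (z.1 - y2) (z.1 - y2) <= (2 * r) ^+ 2 ->
  better r z y2.
have right0 (rho : R) : 0 < rho -> \forall r \near 0^'+, 0 < r /\ r ^+ 2 < rho.
  move=> rho0; near=> r; have r0 : 0 < r by near: r; exact: nbhs_right_gt.
  split=> //; rewrite -[ltRHS]sqr_sqrtr ?ltW// ltr_sqr ?nnegrE ?sqrtr_ge0 ?ltW//.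
  by near: r; apply: nbhs_right_lt; rewrite sqrtr_gt0.
have : \forall r \near 0^'+, B `*` I `<=` P r.
  have /compact_near_coveringP cov := cQ.
  apply: (cov _ _ P) => z0 Qz0.
  have [z0max|] := pselect (forall z, (B `*` I) z -> W z + V z <= W z0 + V z0).
    have [nQ vW vV] := maxP _ Qz0 z0max.
    have [rho rho0 imp] := doubling_improves k0 e0 cW cV tanW tanV
      (filterS z0max nQ) vW vV nQ.
    exists ([set z | sqdist z z0 < rho], [set r | 0 < r /\ r ^+ 2 < rho]).
      by split=> /=; [apply/nbhs_sqdist; exists rho|exact: right0].
    move=> [[y1 t] r] /= [zrho [r0 rrho]] y2 /= y12.
    have [y1' [y2' [Q1 Q2 y12' lt12]]] := imp _ _ _ _ zrho r0 rrho y12.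
    by exists (y1', t), y2'; split=> //; case: Q2.
  move=> /existsNP[z' /not_implyP[Qz' /negP]]; rewrite -ltNge => zz'.
  pose gam := W z' + V z' - (W z0 + V z0); have gam0 : 0 < gam by rewrite /gam; lra.
  have gam2 : 0 < gam / 2 by exact: divr_gt0.
  have /nbhs_sqdist[rho1 rho10 nW] : \forall z \near z0, W z < W z0 + gam / 2.
    by apply: (cvgr_lt _ (cW z0)); rewrite ltrDl.
  have /nbhs_sqdist[rho2 rho20 nV] : \forall z \near z0, V z < V z0 + gam / 2.
    by apply: (cvgr_lt _ (cV z0)); rewrite ltrDl.
  pose rho := Num.min rho1 (rho2 / 16).
  have rho0 : 0 < rho by rewrite lt_min rho10 divr_gt0.
  exists ([set z | sqdist z z0 < rho], [set r | 0 < r /\ r ^+ 2 < rho]).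
    by split=> /=; [apply/nbhs_sqdist; exists rho|exact: right0].
  move=> [z r] /= [zrho [r0 rrho]] y2 y12; exists z', z'.1.
  move: zrho rrho; rewrite /rho !lt_min => /andP[z1 z2] /andP[_ r2].
  split=> //; first by case: Qz'.
    by rewrite subrr dot0l sqr_ge0.
  have Wz := nW _ z1; have := nV (y2, z.2).
  have : sqdist (y2, z.2) z0 < rho2.
    apply: le_lt_trans (sqdist_triangle _ _ z) _.
    rewrite {1}/sqdist /= subrr expr0n addr0 dotB_sym; move: y12.
    by rewrite exprMn; lra.
  move=> y2rho /(_ y2rho) Vz; rewrite -surjective_pairing.
  by move: Wz Vz; rewrite /gam; lra.
have right1 : \forall r \near 0^'+, 0 < r :> R by exact: nbhs_right_gt.
move=> nP; have /(@filter_ex _ _ (at_right_proper_filter 0))[r [Pr r0]] :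
    \forall r \near 0^'+, B `*` I `<=` P r /\ 0 < r :> R by exact: filterI.
pose C := [set u : ('rV[R]_n * R) * 'rV[R]_n |
  dot (u.1.1 - u.2) (u.1.1 - u.2) <= (2 * r) ^+ 2].
have cd : continuous (fun u : ('rV[R]_n * R) * 'rV[R]_n => u.1.1 - u.2).
  move=> u; apply: cvgB; last exact: cvg_snd.
  by apply: (@cvg_comp _ _ _ fst fst); exact: cvg_fst.
have cC : compact (((B `*` I) `*` B) `&` C).
  apply: compact_closedI; first by apply: compact_setX.
  have cdd := continuous_dot cd cd.
  have := @closed_comp _ _ (fun u : ('rV[R]_n * R) * 'rV[R]_n =>
    dot (u.1.1 - u.2) (u.1.1 - u.2)) [set s : R | s <= (2 * r) ^+ 2]
    (fun u _ => cdd u) (@closed_le _ _).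
  exact.
pose G (u : ('rV[R]_n * R) * 'rV[R]_n) := W u.1 + V (u.2, u.1.2).
have cG : continuous G.
  move=> u; apply: cvgD.
    by apply: (@cvg_comp _ _ _ fst W); [exact: cvg_fst|exact: cW].
  have c12 : (fun v : ('rV[R]_n * R) * 'rV[R]_n => v.1.2) @ u --> u.1.2.
    by apply: (@cvg_comp _ _ _ fst snd); [exact: cvg_fst|exact: cvg_snd].
  have c2 : (snd : ('rV[R]_n * R) * 'rV[R]_n -> _) @ u --> u.2 by exact: cvg_snd.
  apply: (@cvg_comp _ _ _ (fun v => (v.2, v.1.2)) V); last exact: cV.
  exact: (cvg_pair c2 c12).
have [|[z y2] [/= [Qz By2] zy2] Gmax] := usc_max _ cC (continuous_usc_on cG).
  have [z Qz] := BI0; exists (z, z.1); split; first by split=> //; case: Qz.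
  by rewrite /C /= subrr dot0l sqr_ge0.
have [z' [y2' [Qz' By2' zy2' lt2]]] := Pr z Qz y2 zy2.
by have := Gmax (z', y2') (conj (conj Qz' By2') zy2'); rewrite /G /= leNgt lt2.
Unshelve. all: by end_near. Qed.

End Doubling.

(** * Comparison in logarithmic form *)

Section LogComparison.
Context (R : realType) (n : nat).
Implicit Types (z w : 'rV[R]_n * R) (K G H : set ('rV[R]_n * R)).
Implicit Types (A B : 'rV[R]_n * R -> R).

(** When the two points get close to each other the sum is controlled by its
    values on the diagonal, uniformly by compactness. *)
Lemma usc_pair_separation K H A B (theta : R) :
  compact H -> H `<=` K -> usc_on K A -> usc_on K B ->
  (forall z, H z -> A z + B z < theta) ->
  exists2 del, 0 < del & forall z1 z2, H z1 -> K z2 -> sqdist z1 z2 < del ->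
    A z1 + B z2 < theta.
Proof.
move=> /compact_near_coveringP cH HK uA uB Hlt.
pose P (del : R) z1 := H z1 -> forall z2, K z2 -> sqdist z1 z2 < del ->
  A z1 + B z2 < theta.
have nP : \forall del \near 0^'+, H `<=` P del.
  apply: (cH _ _ P) => z Hz; have Kz := HK _ Hz; have zlt := Hlt _ Hz.
  pose gam := (theta - (A z + B z)) / 2; have gam0 : 0 < gam by rewrite /gam; lra.
  have Az : A z < A z + gam by rewrite ltrDl.
  have Bz : B z < B z + gam by rewrite ltrDl.
  have /nbhs_sqdist[r1 r10 nA] := uA _ Kz _ Az.
  have /nbhs_sqdist[r2 r20 nB] := uB _ Kz _ Bz.
  pose rho := Num.min r1 (r2 / 4).
  have rho0 : 0 < rho by rewrite lt_min r10 divr_gt0.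
  exists ([set w | sqdist w z < rho], [set d | d < rho]).
    by split=> /=; [apply/nbhs_sqdist; exists rho|exact: nbhs_right_lt].
  move=> [z1 d] /= [zrho drho] Hz1 z2 Kz2 z12.
  move: zrho drho; rewrite /rho !lt_min => /andP[z1r z2r] /andP[_ dr].
  have := nA _ z1r (HK _ Hz1).
  have : sqdist z2 z < r2.
    apply: le_lt_trans (sqdist_triangle _ _ z1) _.
    by rewrite (sqdistC z2); lra.
  by move=> /nB /(_ Kz2); rewrite /gam; lra.
have d0 : \forall del \near 0^'+, 0 < del :> R by exact: nbhs_right_gt.
have /(@filter_ex _ _ (at_right_proper_filter 0))[del [Pdel del0]] :
  \forall d \near 0^'+, H `<=` P d /\ 0 < d :> R by exact: filterI.
by exists del => // z1 z2 Hz1; exact: Pdel.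
Qed.

Lemma supconv_visc_on K A kappa U opt sigma e z :
  is_supconv K A kappa U opt -> visc_on K A sigma e (opt z) ->
  visc_on setT U sigma e z.
Proof. by move=> UP visc a p X XT /(supconv_upper_jet UP); exact: visc. Qed.

(** A large [kappa] keeps [opt z] close to [z] wherever the sum of the
    regularized functions is at least [theta / 2]. Two points of [K] that are
    close to each other and at which A and B have such a sum lie in [G], since
    the sum is at most zero outside; there the inequalities hold. The box is a
    neighbourhood of [K] large enough to contain the maxima in its interior. *)
Lemma log_comparison K G A B (theta e : R) z1 :
  compact K -> open G -> G `<=` K -> usc_on K A -> usc_on K B -> 0 < e ->
  (forall z, G z -> visc_on K A 1 e z) ->
  (forall z, G z -> visc_on K B (-1) 0 z) ->
  (forall z, K z -> ~ G z -> A z + B z <= 0) ->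
  0 < theta -> K z1 -> theta <= A z1 + B z1 -> False.
Proof.
move=> cK oG GK uA uB e0 viscA viscB bdry th0 Kz1 z1th.
have K0 : K !=set0 by exists z1.
pose H := K `&` ~` G.
have cH : compact H by apply: compact_closedI => //; exact: open_closedC.
have HK : H `<=` K by move=> z [].
have th2 : 0 < theta / 2 by exact: divr_gt0.
have HAB z : H z -> A z + B z < theta / 2.
  by move=> [Kz nGz]; apply: le_lt_trans th2; exact: bdry.
have [d1 d10 sepA] := usc_pair_separation cH HK uA uB HAB.
have HBA z : H z -> B z + A z < theta / 2 by rewrite addrC; exact: HAB.
have [d2 d20 sepB] := usc_pair_separation cH HK uB uA HBA.
pose del := Num.min d1 d2; have del0 : 0 < del by rewrite lt_min d10.
have [zA KzA Amax] := usc_max K0 cK uA; have [zB KzB Bmax] := usc_max K0 cK uB.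
pose C := A zA + B zB.
have C0 : 0 < C by have := Amax _ Kz1; have := Bmax _ Kz1; rewrite /C; lra.
pose kappa := C + 8 * C / del.
have C8 : 0 < 8 * C / del by rewrite divr_gt0 ?mulr_gt0.
have k0 : 0 < kappa by rewrite addr_gt0.
have [W [oW WP]] := supconv_exists kappa K0 cK uA.
have [V [oV VP]] := supconv_exists kappa K0 cK uB.
have cW := supconv_continuous cK WP; have cV := supconv_continuous cK VP.
have near_opt z z' : theta / 2 <= W z + V z' ->
    sqdist z (oW z) + sqdist z' (oV z') <= C / kappa.
  have [KW -> _] := WP z; have [KV -> _] := VP z'.
  have := Amax _ KW; have := Bmax _ KV => ? ? WV.
  rewrite ler_pdivlMr// /C; lra.
have Ck : C / kappa <= 1 by rewrite ler_pdivrMr// mul1r lerDl ltW.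
have Cdel : C / kappa <= del / 8.
  rewrite ler_pdivrMr// /kappa mulrDr.
  have -> : del / 8 * (8 * C / del) = C by field; rewrite gt_eqF.
  by rewrite lerDr mulr_ge0 ?divr_ge0 ?(ltW del0) ?(ltW C0).
have inG z z' : theta / 2 <= W z + V z' -> sqdist z z' < del / 8 ->
    G (oW z) /\ G (oV z').
  move=> WV zz'; have opt := near_opt _ _ WV.
  have [KW Wz _] := WP z; have [KV Vz _] := VP z'.
  have sW := sqdist_ge0 z (oW z); have sV := sqdist_ge0 z' (oV z').
  have WVdel : sqdist (oW z) (oV z') < del.
    apply: le_lt_trans (sqdist_triangle _ _ z) _; rewrite (sqdistC _ z).
    have := sqdist_triangle z (oV z') z'; lra.
  have [del1 del2] : del <= d1 /\ del <= d2 by rewrite /del !ge_min !lexx orbT.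
  have ABth : theta / 2 <= A (oW z) + B (oV z').
    have := mulr_ge0 (ltW k0) sW; have := mulr_ge0 (ltW k0) sV.
    by move: WV; rewrite Wz Vz; lra.
  split; apply: contrapT => nG.
    by have := sepA _ _ (conj KW nG) KV (lt_le_trans WVdel del1); lra.
  have := sepB _ _ (conj KV nG) KW; rewrite sqdistC.
  by move=> /(_ (lt_le_trans WVdel del2)); lra.
have c0 : continuous (fun z => sqdist z (0, 0)).
  by apply: (@continuous_sqdist _ _ _ id (fun=> (0, 0))) => z; [exact: cvg_id|exact: cvg_cst].
have [zM KzM Mmax] := usc_max K0 cK (continuous_usc_on c0).
set M := sqdist zM (0, 0) in Mmax.
have M0 : 0 <= M by exact: sqdist_ge0.
pose Bx := [set y : 'rV[R]_n | dot (y - 0) (y - 0) <= 2 * M + 3].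
pose It := `[- (2 * M + 3), 2 * M + 3]%classic.
have inBox z : sqdist z (0, 0) < 2 * M + 3 -> (Bx `*` It) z.
  rewrite /sqdist /= !subr0 => zM'; split=> /=.
    by rewrite /Bx /= subr0; have := sqr_ge0 z.2; lra.
  rewrite /It /= in_itv /=; have := dot_ge0 z.1.
  have := sqr_ge0 (z.2 - 1); have := sqr_ge0 (z.2 + 1).
  by move=> ? ? ?; apply/andP; split; lra.
apply: (doubling_contradiction (ltW k0) e0 cW cV (B := Bx) (I := It)).
- by move=> z; exact: (supconv_lower_tangent z WP).
- by move=> z; exact: (supconv_lower_tangent z VP).
- exact: compact_dot_ball.
- exact: segment_compact.
- by exists z1; apply: inBox; apply: le_lt_trans (Mmax _ Kz1) _; lra.
move=> z0 Qz0 z0max.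
have z0th : theta <= W z0 + V z0.
  have : W z1 + V z1 <= W z0 + V z0.
    by apply: z0max; apply: inBox; apply: le_lt_trans (Mmax _ Kz1) _; lra.
  have [_ _ /(_ _ Kz1)] := WP z1; have [_ _ /(_ _ Kz1)] := VP z1.
  by rewrite sqdistxx mulr0 !subr0; lra.
have del8 : 0 < del / 8 by exact: divr_gt0.
have nz0 : \forall z \near z0, sqdist z z0 < del / 8.
  by apply/nbhs_sqdist; exists (del / 8).
split.
- have : sqdist z0 (0, 0) < 2 * M + 3.
    apply: le_lt_trans (sqdist_triangle _ _ (oW z0)) _.
    have [KW _ _] := WP z0; have := Mmax _ KW.
    have : theta / 2 <= W z0 + V z0 by lra.
    move=> /near_opt; have := sqdist_ge0 z0 (oV z0); lra.
  by move=> /(cvgr_lt _ (c0 z0)); apply: filterS => z; exact: inBox.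
- have nW : \forall z \near z0, W z0 - theta / 2 < W z.
    by apply: (cvgr_gt _ (cW z0)); rewrite ltrBlDr ltrDl.
  apply: filterS2 nW nz0 => z Wz zz0.
  have [|GW _] := inG z z0 _ zz0; first by lra.
  exact: (supconv_visc_on WP (viscA _ GW)).
- have nV : \forall z \near z0, V z0 - theta / 2 < V z.
    by apply: (cvgr_gt _ (cV z0)); rewrite ltrBlDr ltrDl.
  apply: filterS2 nV nz0 => z Vz; rewrite sqdistC => zz0.
  have [|_ GV] := inG z0 z _ zz0; first by lra.
  exact: (supconv_visc_on VP (viscB _ GV)).
Qed.

End LogComparison.

(** * From the equation to its logarithmic form *)

Section LogTransform.
Context (R : realType) (n : nat).
Implicit Types (z w : 'rV[R]_n * R) (D K : set ('rV[R]_n * R)).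

(** A quadratic error in time is of higher order, since jets are of first order
    in time. *)
Lemma upper_jet_time_penalty D (A f : 'rV[R]_n * R -> R) z a p X (c L : R) :
  (forall w, D w -> f w - f z <=
     A w - A z + c * (w.2 - z.2) + L * (w.2 - z.2) ^+ 2) ->
  upper_jet D A z a p X -> upper_jet D f z (a + c) p X.
Proof.
move=> fA jet e e0; have e20 : 0 < e / 2 by exact: divr_gt0.
apply: filterS2 (time_sqr_small z L e20) (jet _ e20) => w Ltau Aw Dw.
have := Aw Dw; have := fA _ Dw.
have := mulr_ge0 (ltW e0) (dot_ge0 (w.1 - z.1)); lra.
Qed.

Lemma log_jet_quadratic (c sigma : R) (p : 'rV[R]_n) (X : 'M[R]_n) :
  dot ((c *: p) *m (c *: (X + sigma *: (p^T *m p)))) (c *: p) =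
  c ^+ 3 * (dot (p *m X) p + sigma * dot p p ^+ 2).
Proof.
rewrite -scalemxAl -!scalemxAr !dotZl dotZr mulmxDr dotDl -scalemxAr dotZl.
by rewrite dot_mul_outer; ring.
Qed.

Lemma log_jet_sym (c sigma : R) (p : 'rV[R]_n) (X : 'M[R]_n) :
  X^T = X -> (c *: (X + sigma *: (p^T *m p)))^T = c *: (X + sigma *: (p^T *m p)).
Proof. by move=> XT; rewrite linearZ/= linearD/= linearZ/= trmx_mul trmxK XT. Qed.

(** A jet [(a, p, X)] of ln u is the jet
    [u *: (a, p, X + p^T *m p)] of u; in the equation for u a common factor
    [u ^+ 3] comes out and the rank-one term yields |p|^4. *)
Lemma ln_visc_subsolution D K u (psi dpsi : R -> R) (L e : R) z :
  viscosity_subsolution D u -> D z -> K z -> (\forall w \near z, D w -> K w) ->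
  (forall w, K w -> 0 < u w) ->
  (forall s t, psi t - psi s <= dpsi s * (t - s) + L * (t - s) ^+ 2) ->
  (forall s, e <= dpsi s) ->
  visc_on K (fun w => ln (u w) - psi w.2) 1 e z.
Proof.
move=> [_ visc] Dz Kz DK u0 psi2 epsi a p X XT jet.
have uz := u0 _ Kz.
have jetln : upper_jet K (fun w => ln (u w)) z (a + dpsi z.2) p X.
  apply: (@upper_jet_time_penalty K (fun w => ln (u w) - psi w.2) _ z a p X
    (dpsi z.2) L _ jet) => w Kw.
  have /= := psi2 z.2 w.2.
  move: (ln (u w)) (ln (u z)) (psi w.2) (psi z.2) => a1 a2 a3 a4; lra.
have uE w : K w -> u w = 1 * expR (1 * ln (u w)).
  by move=> /u0 uw; rewrite !mul1r lnK.
have := upper_jet_exp (or_introl erefl) Kz uE jetln.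
rewrite /= mul1r lnK// => /(upper_jet_near DK) jetu.
have := visc _ _ _ _ Dz (upper_jet_superjet (log_jet_sym _ _ _ XT) jetu).
rewrite log_jet_quadratic.
have -> : 3 * (u z * (a + dpsi z.2)) * u z ^+ 2 =
    u z ^+ 3 * (3 * (a + dpsi z.2)) by ring.
rewrite -mulrBr pmulr_rge0 ?exprn_gt0// mul1r; have := epsi z.2; lra.
Qed.

Lemma ln_visc_supersolution D K v z :
  viscosity_supersolution D v -> D z -> K z -> (\forall w \near z, D w -> K w) ->
  (forall w, K w -> 0 < v w) ->
  visc_on K (fun w => - ln (v w)) (-1) 0 z.
Proof.
move=> [_ visc] Dz Kz DK v0 a p X XT jet.
have vz := v0 _ Kz.
have vE w : K w -> (\- v) w = -1 * expR (-1 * - ln (v w)).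
  by move=> /v0 vw; rewrite !mulN1r opprK lnK.
have := upper_jet_exp (or_intror erefl) Kz vE jet.
rewrite /= mulN1r opprK lnK// => /(upper_jet_near DK) jetv.
have sj := upper_jet_superjet (log_jet_sym _ _ _ XT) jetv.
have := visc _ _ _ _ Dz (ex_intro2 _ _ _ sj erefl).
rewrite mulNmx mulmxN opprK dotNr log_jet_quadratic.
have -> : 3 * - (v z * a) * v z ^+ 2 = - (v z ^+ 3 * (3 * a)) by ring.
rewrite opprK addrC -mulrBr pmulr_rle0 ?exprn_gt0//; lra.
Qed.

End LogTransform.

Theorem theorem3p3 (R : realType) (n : nat) (Omega : set 'rV[R]_n) (T : R)
  (u v : 'rV[R]_n * R -> R) :
  (2 <= n)%N ->
  domain Omega -> bounded_set Omega -> 0 < T ->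
  let OmegaT := cylinder Omega T in
  let PT := parabolic_boundary Omega T in
  upper_semicontinuous_on (OmegaT `|` PT) u ->
  lower_semicontinuous_on (OmegaT `|` PT) v ->
  viscosity_subsolution OmegaT u ->
  viscosity_supersolution OmegaT v ->
  (0 < mine (ereal_inf [set (u z)%:E | z in OmegaT `|` PT])
            (ereal_inf [set (v z)%:E | z in OmegaT `|` PT]))%E ->
  (ereal_sup [set (v z)%:E | z in PT] < +oo)%E ->
  (forall z, PT z -> u z <= v z) ->
  forall z, OmegaT z -> u z <= v z.
Proof.
move=> _ [_ oOmega _] bOmega T0 OmegaT PT uscu lscv subu superv inf0 _ uvPT z Oz.
have [u0 v0] : (forall w, (OmegaT `|` PT) w -> 0 < u w) /\
    (forall w, (OmegaT `|` PT) w -> 0 < v w).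
  move: inf0; rewrite lt_min => /andP[infu infv].
  split=> w Dw; rewrite -lte_fin.
    by apply: lt_le_trans infu _; apply: ereal_inf_lbound; exists w.
  by apply: lt_le_trans infv _; apply: ereal_inf_lbound; exists w.
rewrite leNgt; apply/negP => uv.
case: z Oz uv => x0 t0 [/= Ox0]; rewrite in_itv /= => /andP[t00 t0T] uv.
pose T2 := (t0 + T) / 2.
have [t0T2 T2T] : t0 < T2 /\ T2 < T by rewrite /T2; split; lra.
(* Stopping before [T] makes the closed cylinder a compact subset of the domain
   of semicontinuity. *)
pose K := closure Omega `*` `[0, T2]%classic.
pose G := Omega `*` `]0, T2[%classic.
have GO : G `<=` OmegaT.
  move=> [x t] [/= Ox]; rewrite in_itv /= => /andP[t1 t2]; split=> //=.
  by rewrite in_itv /= t1 (lt_trans t2).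
have GK : G `<=` K.
  move=> [x t] [/= Ox]; rewrite in_itv /= => /andP[t1 t2].
  by split=> /=; [exact: subset_closure|rewrite in_itv /= !ltW].
have KPT w : K w -> ~ G w -> PT w \/ (Omega w.1 /\ w.2 = T2).
  case: w => x t [/= cx]; rewrite in_itv /= => /andP[t1 t2] nG.
  have [Ox|nOx] := pselect (Omega x); last first.
    left; right; split=> /=.
      by split=> // /interior_subset.
    by rewrite in_itv /= t1 (le_lt_trans t2).
  have [->|tn0] := eqVneq t 0; first by left; left.
  have [->|tnT] := eqVneq t T2; first by right.
  exfalso; apply: nG; split=> //=.
  by rewrite in_itv /= !lt_neqAle eq_sym tn0 t1 tnT t2.
have KD : K `<=` OmegaT `|` PT.
  move=> w Kw; have [Gw|nG] := pselect (G w); first by left; exact: GO.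
  have [PTw|[Ow wT]] := KPT _ Kw nG; first by right.
  left; split=> //=; rewrite wT in_itv /= T2T andbT; exact: lt_trans t0T2.
have cK : compact K.
  apply: compact_setX; last exact: segment_compact.
  apply: bounded_closed_compact; last exact: closed_closure.
  have [M [_ OM]] := bOmega.
  have OM1 : Omega `<=` [set x | `|x| <= M + 1].
    by move=> x Ox; apply: OM => //; rewrite ltrDl.
  have cM : closed [set x : 'rV[R]_n | `|x| <= M + 1].
    apply: (@closed_comp _ _ (fun x : 'rV[R]_n => `|x|) [set r | r <= M + 1]).
      by move=> x _; exact: norm_continuous.
    exact: closed_le.
  exists (M + 1); split=> [|r Mr x /(closureS OM1)]; first exact: num_real.
  by rewrite -(closure_id _).1// => /le_trans; apply; exact: ltW.
have oG : open G.
  have -> : G = fst @^-1` Omega `&` snd @^-1` `]0, T2[%classic by [].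
  apply: openI; apply: open_comp => //.
    by move=> w _; exact: cvg_fst.
  by move=> w _; exact: cvg_snd.
have u0K w : K w -> 0 < u w by move=> /KD; exact: u0.
have v0K w : K w -> 0 < v w by move=> /KD; exact: v0.
have uln : usc_on K (fun w => ln (u w)).
  by apply: usc_on_ln => //; apply: usc_onS KD (upper_semicontinuous_on_usc uscu).
have vln : usc_on K (fun w => - ln (v w)).
  apply: usc_on_lnN => //; apply: usc_onS KD (upper_semicontinuous_on_usc _).
  rewrite /upper_semicontinuous_on (_ : \- \- v = v)//.
  by apply/funext => w /=; exact: opprK.
have Gz : G (x0, t0) by split=> //=; rewrite in_itv /= t00.
have K0 : K !=set0 by exists (x0, t0); exact: GK.
have [zu _ umax] := usc_max K0 cK uln; have [zv _ vmax] := usc_max K0 cK vln.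
pose th := ln (u (x0, t0)) - ln (v (x0, t0)).
have th0 : 0 < th.
  by rewrite subr_gt0 ltr_ln ?posrE//; [exact/v0K/GK|exact/u0K/GK].
pose e := th / (2 * t0); have e0 : 0 < e by rewrite divr_gt0// mulr_gt0.
pose C := `|ln (u zu)| + `|- ln (v zv)|.
have C0 : 0 <= C by rewrite addr_ge0.
pose L := C / (T2 - t0) ^+ 2.
have T2t0 : 0 < (T2 - t0) ^+ 2 by rewrite exprn_gt0 ?subr_gt0.
have L0 : 0 <= L by rewrite divr_ge0// ltW.
(* The penalty is [e * t0], half of the excess, at time [t0], and at least [C]
   at time [T2]. *)
pose pos (s : R) := Num.max 0 (s - t0).
have pos0 s : 0 <= pos s by rewrite le_max lexx.
pose psi s := e * s + L * pos s ^+ 2.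
pose dpsi s := e + 2 * L * pos s.
have psi2 s t : psi t - psi s <= dpsi s * (t - s) + L * (t - s) ^+ 2.
  have : pos t ^+ 2 <= (pos s + (t - s)) ^+ 2.
    rewrite {1}/pos; case: (leP 0 (t - t0)) => t1; last by rewrite expr0n sqr_ge0.
    rewrite ler_sqr ?nnegrE//; have : s - t0 <= pos s by rewrite le_max lexx orbT.
      by lra.
    by have : s - t0 <= pos s by [rewrite le_max lexx orbT]; lra.
  by move=> /(ler_wpM2l L0); rewrite /psi /dpsi; lra.
have edpsi s : e <= dpsi s.
  by rewrite lerDl; apply: mulr_ge0 => //; exact: mulr_ge0.
pose A w := ln (u w) - psi w.2; pose B w := - ln (v w).
have uA : usc_on K A.
  apply: usc_onD => //; apply: continuous_usc_on => w.
  have cpos : (fun w' : 'rV[R]_n * R => pos w'.2) @ w --> pos w.2.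
    apply: (@continuous_max _ _ (fun=> 0) (fun w' : 'rV[R]_n * R => w'.2 - t0)).
      exact: cvg_cst.
    exact: continuous_timeB.
  apply: cvgN; apply: cvgD; apply: cvgM; try exact: cvg_cst.
    exact: cvg_snd.
  by apply: cvgM; exact: cpos.
have DK w : G w -> \forall w' \near w, OmegaT w' -> K w'.
  move=> Gw; have : nbhs w G by exact: open_nbhs_nbhs.
  by apply: filterS => w' /GK.
apply: (@log_comparison _ _ K G A B (th / 2) e (x0, t0) cK oG GK uA vln e0).
- move=> w Gw; apply: (ln_visc_subsolution subu _ _ _ _ psi2 edpsi) => //.
  + exact: GO.
  + exact: GK.
  + exact: DK.
- move=> w Gw; apply: (ln_visc_supersolution superv) => //.
  + exact: GO.
  + exact: GK.
  + exact: DK.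
- move=> w Kw nGw; rewrite /A /B.
  have w20 : 0 <= w.2 by case: Kw => _ /=; rewrite in_itv /= => /andP[].
  have e20 : 0 <= e * w.2 by rewrite mulr_ge0// ltW.
  have [PTw|[_ wT]] := KPT _ Kw nGw.
    have : ln (u w) <= ln (v w) by rewrite ler_ln ?posrE ?u0K ?v0K ?uvPT.
    have : 0 <= L * pos w.2 ^+ 2 by rewrite mulr_ge0 ?sqr_ge0.
    by rewrite /psi; lra.
  have -> : psi w.2 = e * w.2 + C.
    rewrite /psi wT /pos max_r ?subr_ge0 ?(ltW t0T2)// /L.
    by rewrite divfK ?gt_eqF.
  have := umax _ Kw; have := vmax _ Kw; have := ler_norm (ln (u zu)).
  have := ler_norm (- ln (v zv)); rewrite /C; lra.
- exact: divr_gt0.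
- exact: GK.
- rewrite /A /B /psi /pos /= subrr max_l// expr0n /= mulr0 addr0.
  have -> : e * t0 = th / 2 by rewrite /e; field; rewrite gt_eqF.
  by rewrite /th; lra.
Qed.
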